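(* Let $\varrho$ be an irreducible substitution on a compact Hausdorff alphabet $\mathcal{A}$ such that $T=M/r$ is strongly power convergent. Then $\varrho$ admits a natural length function $\ell\in K$ with inflation factor $\lambda=r>1$. Moreover, $\ell$ is an essentially unique natural length function (every natural length function of $\varrho$ is a scalar multiple of $\ell$), and $\ell(a)>0$ for all $a\in\mathcal{A}$. With respect to this length function, the tiling dynamical system $(\Omega,\mathbb{R})$ is uniquely ergodic, i.e. there is exactly one $\mathbb{R}$-invariant regular Borel probability measure on $\Omega$.
   Context: Alphabets and substitutions. $\mathcal{A}$ is a compact Hausdorff space. $\mathcal{A}^+ = \bigsqcup_{n\ge 1}\mathcal{A}^n$ is the space of non-empty finite words (disjoint union of product topologies), $\mathcal{A}^*=\mathcal{A}^+\sqcup\{\varepsilon\}$ with $\varepsilon$ the empty word, $|u|$ is the length of $u$, and $u\triangleleft v$ means $u$ is a (contiguous) subword of $v$. A substitution is a continuous map $\varrho\colon\mathcal{A}\to\mathcal{A}^+$, extended to words by concatenation and iterated. Standing assumption: $|\varrho(a)|\ge 2$ for some $a\in\mathcal{A}$. Irreducible: there is no non-empty closed $C\subsetneq\mathcal{A}$ such that $\varrho(c)$ contains only letters in $C$ for all $c\in C$. Operator. $E=C(\mathcal{A})$ is the Banach space of continuous real-valued functions with the supremum norm, $K=\{f\in E: f\ge 0\}$. $M\colon E\to E$, $(Mf)(a)=\sum_{b\triangleleft\varrho(a)}f(b)$, summing over all letters of $\varrho(a)$ with multiplicity; $r$ is the spectral radius of $M$. $T$ is strongly power convergent if $\lim_{n\to\infty}T^n(f)$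 exists in $E$ for every $f\in E$. Natural length function with inflation factor $\lambda\ge0$: a non-zero $\ell\in K$ with $M\ell=\lambda\ell$. Subshift. A word is generated by $\varrho$ if it is a subword of $\varrho^k(a)$ for some $a\in\mathcal{A}$, $k\ge0$; $\mathcal{L}(\varrho)\subseteq\mathcal{A}^*$ is the closure of the set of generated words; $X_\varrho\subseteq\mathcal{A}^{\mathbb{Z}}$ is the set of bi-infinite sequences all of whose finite subwords lie in $\mathcal{L}(\varrho)$, with shift $\sigma(x)_i=x_{i+1}$. Geometric hull. For a strictly positive natural length function $\ell$, the geometric hull (tiling space) $\Omega$ is the space of tilings of $\mathbb{R}$ by labelled intervals, where a tile labelled $a$ is a translate of $[0,\ell(a)]$ and the bi-infinite sequence of labels belongs to $X_\varrho$; $\mathbb{R}$ acts by translation. It is identified, topologically and dynamically, with the suspension $(X_\varrho\times\mathbb{R})/\!\sim$, where $\sim$ is the equivalence relation generated by $(x,s+\ell(x_0))\sim(\sigma(x),s)$ for $x\in X_\varrho$, $s\in\mathbb{R}$, with action $t\cdot[(x,s)]=[(x,s-t)]$. *)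

(* Defs.v *)
From HB Require Import structures.
From Stdlib Require Import Relations.
From mathcomp Require Import all_boot all_order all_algebra.
From mathcomp Require Import generic_quotient.
From mathcomp Require Import all_classical all_reals all_analysis.
From mathcomp Require Import complex.
Set Implicit Arguments.
Unset Strict Implicit.
Unset Printing Implicit Defensive.
Import Order.TTheory GRing.Theory Num.Theory.
Import numFieldNormedType.Exports.
Local Open Scope classical_set_scope.
Local Open Scope ring_scope.

(* Finite words are sequences of letters. [word_sig] is a bijection onto the
   disjoint union of the products A^n, n >= 0, along which [word A] receives
   its topology; the empty word is an isolated point. *)
Section Words.
Variable A : topologicalType.

Definition word_sig (u : seq A) : {n : nat & {ptws 'I_n -> A}} :=
  existT (fun n => {ptws 'I_n -> A}) (size u) (tnth (in_tuple u)).

Definition word := seq A.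
HB.instance Definition _ := Choice.on word.
HB.instance Definition _ :=
  Topological.copy word (initial_topology word_sig).

End Words.

Section Substitutions.
Variable A : topologicalType.

Record substitution := Substitution {
  subst_fun :> A -> seq A;
  subst_nonempty : forall a, subst_fun a != [::];
  subst_continuous : continuous (subst_fun : A -> word A)
}.

Variable rho : substitution.

Definition subst_word (u : seq A) : seq A := flatten [seq rho a | a <- u].

Definition irreducible : Prop :=
  ~ exists C : set A, [/\ closed C, C !=set0, C != setT &
      forall c, C c -> forall b, b \in rho c -> C b].

Definition generated : set (word A) :=
  [set u | exists a k, infix u (iter k subst_word [:: a])].

Definition language : set (word A) := closure generated.

Definition factor (x : int -> A) (i : int) (n : nat) : word A :=
  mkseq (fun k => x (i + k%:Z)) n.

Definition subshift : set {ptws int -> A} :=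
  [set x | forall i n, language (factor x i n)].

Definition shift (x : {ptws int -> A}) : {ptws int -> A} :=
  fun i => x (i + 1).

Lemma shift_subshift x : subshift x -> subshift (shift x).
Proof.
move=> Xx i n; suff -> : factor (shift x) i n = factor x (i + 1) n by [].
by apply: eq_mkseq => k; rewrite /shift addrAC.
Qed.

Definition shiftX (x : subshift) : subshift :=
  SigSub (mem_set (shift_subshift (set_valP x))).

Definition subst_op (V : nmodType) (f : A -> V) (a : A) : V :=
  \sum_(b <- rho a) f b.

End Substitutions.

(* Operators on C(A, K) are maps on all functions A -> K, of which only the
   values at continuous functions matter. *)
Section Operators.
Variables (A : topologicalType) (K : numFieldType).
Implicit Types (S T : (A -> K) -> (A -> K)) (f g : A -> K).

Definition bounded_operator S : Prop :=
  [/\ forall f, continuous f -> continuous (S f),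
      forall (z : K) f g, continuous f -> continuous g ->
        S (fun a => z * f a + g a) = (fun a => z * S f a + S g a) &
      exists k : K, forall f (c : K), continuous f ->
        (forall a, `|f a| <= c) -> forall a, `|S f a| <= k * c].

Definition resolvent_set T : set K :=
  [set z | exists2 S, bounded_operator S & forall f, continuous f ->
     S (fun a => z * f a - T f a) = f /\
     (fun a => z * S f a - T (S f) a) = f].

Definition spectrum T : set K := ~` resolvent_set T.

End Operators.

Section RealOperators.
Variables (R : realType) (A : topologicalType).

(* The spectrum of a real operator is that of its complexification; that of
   M acts on C(A, R[i]) by the same formula as M. *)
Definition spectral_radius (rho : substitution A) : R :=
  sup [set x : R | exists2 z : (R[i] : numFieldType),
    @spectrum A (R[i] : numFieldType) (@subst_op A rho (R[i] : numFieldType)) z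
    & `|z| = x%:C%C].

Definition strongly_power_convergent (T : (A -> R) -> (A -> R)) : Prop :=
  forall f : A -> R, continuous f ->
  exists2 g : A -> R, continuous g &
    {uniform, (fun n => iter n T f) @ \oo --> g}.

Definition natural_length (rho : substitution A) (l : A -> R) (lambda : R) :=
  [/\ continuous l, forall a, 0 <= l a, exists a, l a != 0, 0 <= lambda &
      forall a, subst_op rho l a = lambda * l a].

End RealOperators.

(* The geometric hull, as the suspension of the subshift with roof function
   x |-> l (x 0). *)
Section Hull.
Variables (R : realType) (A : topologicalType).
Variables (rho : substitution A) (l : A -> R).

Definition hull_cover : Type := (subshift rho * R)%type.
HB.instance Definition _ := Topological.on hull_cover.

Definition hull_step (p q : hull_cover) : Prop :=
  exists (x : subshift rho) (s : R),
    p = (x, s + l (set_val x 0)) /\ q = (shiftX x, s).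

Definition hull_rel_fun : rel hull_cover :=
  fun p q => `[< clos_refl_sym_trans hull_cover hull_step p q >].

Lemma hull_rel_refl : reflexive hull_rel_fun.
Proof. by move=> p; apply/asboolP; exact: rst_refl. Qed.

Lemma hull_rel_sym : symmetric hull_rel_fun.
Proof. by move=> p q; apply/asboolP/asboolP => ?; exact: rst_sym. Qed.

Lemma hull_rel_trans : transitive hull_rel_fun.
Proof.
move=> q p u /asboolP pq /asboolP qu; apply/asboolP.
exact: rst_trans pq qu.
Qed.

Definition hull_rel :=
  EquivRel hull_rel_fun hull_rel_refl hull_rel_sym hull_rel_trans.

Local Open Scope quotient_scope.

Definition hull := quotient_topology {eq_quot hull_rel}.
HB.instance Definition _ := Topological.on hull.

Definition translate (t : R) (w : hull) : hull :=
  \pi_hull ((repr w).1, (repr w).2 - t).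

Lemma translateE t x s : translate t (\pi_hull (x, s)) = \pi_hull (x, s - t).
Proof.
have /eqmodP/asboolP : repr (\pi_hull (x, s)) = (x, s) %[mod hull].
  by rewrite reprK.
rewrite /translate; move: (repr _) => w wxs; apply/eqmodP/asboolP.
have -> : (x, s - t) = ((x, s).1, (x, s).2 - t) by [].
have stepB : forall p q, hull_step p q ->
    hull_step (p.1, p.2 - t) (q.1, q.2 - t).
  by move=> _ _ [y [v [-> ->]]]; exists y, (v - t); rewrite /= addrAC.
elim: wxs => [p q /stepB|p|p q _|p q u _ pq _ qu].
- exact: rst_step.
- exact: rst_refl.
- exact: rst_sym.
- exact: rst_trans pq qu.
Qed.

End Hull.

(* [measurableType] requires a base point. *)
Definition pointed_at (T : topologicalType) (x0 : T) : Type := T.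
HB.instance Definition _ (T : topologicalType) (x0 : T) :=
  Topological.on (pointed_at x0).
HB.instance Definition _ (T : topologicalType) (x0 : T) :=
  isPointed.Build (pointed_at x0) x0.

Definition borel (T : topologicalType) (x0 : T) :=
  g_sigma_algebraType (@open (pointed_at x0)).

Section UniqueErgodicity.
Variables (R : realType) (T : topologicalType).
Local Open Scope ereal_scope.

Definition regular_measure (x0 : T) (mu : probability (borel x0) R) : Prop :=
  forall B : set (borel x0), measurable B ->
    mu B = ereal_inf [set mu U | U in [set U : set T | open U /\ B `<=` U]] /\
    mu B = ereal_sup [set mu K | K in
      [set K : set T | [/\ compact K, measurable (K : set (borel x0)) &
                           K `<=` B]]].

Definition invariant_measure (act : R -> T -> T) (x0 : T)
    (mu : probability (borel x0) R) : Prop :=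
  forall (t : R) (B : set (borel x0)), measurable B ->
    mu (act t @^-1` B) = mu B.

(* A space that carries a probability measure is non-empty; the base point x0
   affects neither the Borel sets nor the measures. Measures of the library are
   defined on all sets, hence are compared on Borel sets only. *)
Definition uniquely_ergodic (act : R -> T -> T) : Prop :=
  exists (x0 : T) (mu : probability (borel x0) R),
    [/\ invariant_measure act mu, regular_measure mu &
        forall nu : probability (borel x0) R,
          invariant_measure act nu -> regular_measure nu ->
          forall B : set (borel x0), measurable B -> nu B = mu B].

End UniqueErgodicity.

(* Main.v *)
(* Let r be the spectral radius and M^n f / r^n -> P f. Since M is positive, r is
   positive and |rho^n| is not o(r^n), so l = P 1 is a non-zero fixed point of
   M / r. The zero set of a non-negative eigenfunction is invariant, hence empty
   by irreducibility; applied to the difference of one eigenfunction and the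
   largest admissible multiple of another one, this gives uniqueness of l and
   P f = phi(f) l. Comparing l with its minimum gives r > 1.

   For a continuous function G on the full shift, let W_n(a) be the sum of G over
   the positions of rho^n(a), padded by a fixed letter. Up to boundary terms W is
   additive, so W_n / (r^n l) converges uniformly to a constant, and cutting words
   of the language into blocks rho^j(b) shows that sums of G along any orbit of
   the subshift grow like a constant times the length covered. Consequently
   finite averages of a continuous function over translations of the hull come
   uniformly close to constants. These constants define an invariant positive
   functional, whose Riesz measure is the invariant measure; conversely, they
   determine every invariant regular measure. *)

From HB Require Import structures.
From Stdlib Require Import Relations.
Require Import Defs.
From mathcomp Require Import all_boot all_order all_algebra.
From mathcomp Require Import generic_quotient complex ring lra zify.
From mathcomp Require Import all_classical all_reals all_analysis.
From mathcomp Require Import measurable_realfun unstable.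
Set Implicit Arguments.
Unset Strict Implicit.
Unset Printing Implicit Defensive.
Import Order.TTheory GRing.Theory Num.Theory.
Import numFieldNormedType.Exports.
Local Open Scope classical_set_scope.
Local Open Scope ring_scope.

(* [factor] is also the name of a lemma of the library. *)
Local Notation factor := Defs.factor.

(** * Riesz measures and unique ergodicity *)

(** The abstract spectrum is reached through two facts only. If |rho^k| grows at most like th^k, the
    Neumann series puts every z with |z| > th into the resolvent set, so r <= th; and positivity of
    M forces some positive real into the spectrum. Since the first fact bounds r from above, a decay
    |rho^n| <= r^n / 2 at a single n already contradicts it, which is why the limit of M^n 1 / r^n
    is not zero.

    A padded word need not lie in the subshift, so window sums require G on the whole full shift,
    whereas functions coming from the hull live on the subshift and have to be extended.

    Time averages are taken over finite lists of times. Such averages compose and commute, because R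
    is abelian, so existence, uniqueness and additivity of the mean of a function need no integrals.
    Measures are compared through Urysohn functions squeezed between indicators of a compact and an
    open set. *)

Lemma urysohn_compact (R : realType) (T : topologicalType) (K F : set T) :
  compact [set: T] -> hausdorff_space T -> closed K -> closed F ->
  K `&` F = set0 ->
  exists f : T -> R, [/\ continuous f, forall w, 0 <= f w <= 1,
    forall w, K w -> f w = 1 & forall w, F w -> f w = 0].
Proof.
move=> cT hT cK cF; rewrite setIC => KF0.
have := (@normal_separatorP R T).1 (compact_normal hT cT) F K cF cK KF0.
move=> /(uniform_separatorP (R := R))[f [cf f01 f0 f1]].
exists f; split=> // w.
- by have := f01 (f w) (ex_intro2 _ _ w I erefl); rewrite /= in_itv.
- by move=> Kw; exact: (f1 (f w) (ex_intro2 _ _ w Kw erefl)).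
- by move=> Fw; exact: (f0 (f w) (ex_intro2 _ _ w Fw erefl)).
Qed.

(* Only open sets are given a mass directly, and the functions used vanish off
   the open set instead of having their support inside; truncating [f] to
   [(f - e)^+] makes up for the difference. *)
Section RieszMeasure.
Variables (R : realType) (T : topologicalType).
Hypotheses (cT : compact [set: T]) (hT : hausdorff_space T).
Variable L : (T -> R) -> R.
Hypothesis LD : forall f g, continuous f -> continuous g ->
  L (f \+ g) = L f + L g.
Hypothesis L_le : forall f g, continuous f -> continuous g ->
  (forall w, f w <= g w) -> L f <= L g.
Hypothesis L_cst : forall c : R, L (fun=> c) = c.
Local Open Scope ereal_scope.

Definition dominated_by (U : set T) (f : T -> R) : Prop :=
  [/\ continuous f, forall w, (0 <= f w <= 1)%R & forall w, ~ U w -> f w = 0%R].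

Definition open_mass (U : set T) : \bar R :=
  ereal_sup [set (L f)%:E | f in dominated_by U].

Definition outer_mass (B : set T) : \bar R :=
  ereal_inf [set open_mass U | U in [set U : set T | open U /\ B `<=` U]].

Let trunc (e : R) (f : T -> R) (w : T) : R := Num.max (f w - e)%R 0%R.

Let continuous_trunc e f : continuous f -> continuous (trunc e f).
Proof.
move=> cf w; suff : {for w, continuous ((fun w => f w - e)%R \max (fun=> 0%R))}.
  exact.
apply: continuous_max; last exact: cvg_cst.
by apply: cvgB; [exact: cf|exact: cvg_cst].
Qed.

(** The level set [e <= f] stands in for a compact support inside [U], which [f] itself need not
    have. *)
Let truncP e (e0 : (0 < e)%R) f U : dominated_by U f ->
  [/\ dominated_by U (trunc e f),
      forall w, (f w <= trunc e f w + e)%R,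
      closed [set w | (e <= f w)%R],
      [set w | (e <= f w)%R] `<=` U &
      forall w, ~ [set w | (e <= f w)%R] w -> trunc e f w = 0%R].
Proof.
move=> [cf f01 fU].
have off w : ~ [set w | (e <= f w)%R] w -> trunc e f w = 0%R.
  by move=> /negP; rewrite -ltNge => fe; apply/max_idPr; rewrite subr_le0 ltW.
have sub : [set w | (e <= f w)%R] `<=` U.
  move=> w /= ef; apply: contrapT => /fU fw; move: ef.
  by rewrite fw leNgt e0.
split=> //.
- split; [exact: continuous_trunc| |].
  + move=> w; rewrite le_max lexx orbT /= ge_max ler01 andbT.
    by have /andP[_ fw1] := f01 w; rewrite lerBlDr (le_trans fw1)// lerDl ltW.
  + by move=> w nU; apply: off => /sub.
- by move=> w; rewrite -lerBlDr le_max lexx.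
- apply: (@closed_comp _ _ f [set x : R | (e <= x)%R]) => [w _|]; first exact: cf.
  exact: closed_ge.
Qed.

Let dominated_cst0 U : dominated_by U (fun=> 0%R).
Proof. by split=> [w|w|//]; [exact: cvg_cst|rewrite lexx ler01]. Qed.

Let dominated_L U f : dominated_by U f -> (L f)%:E <= open_mass U.
Proof. by move=> dUf; apply: ereal_sup_ubound; exists f. Qed.

Let L_trunc e (e0 : (0 < e)%R) f U : dominated_by U f ->
  (L f <= L (trunc e f) + e)%R.
Proof.
move=> dUf; have [[ct _ _] le _ _ _] := truncP e0 dUf.
have [cf _ _] := dUf.
rewrite -{2}(L_cst e) -LD//; last by move=> ?; exact: cvg_cst.
by apply: L_le => //= w; apply: cvgD; [exact: ct|exact: cvg_cst].
Qed.

(** Truncation costs at most [e] under [L], so upper bounds on [open_mass] need only be checked on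
    truncated functions. *)
Let open_mass_le U x : (forall e f, (0 < e)%R -> dominated_by U f ->
  (L (trunc e f))%:E <= x) -> open_mass U <= x.
Proof.
move=> H; apply: ge_ereal_sup => _ [f dUf <-].
apply/lee_addgt0Pr => e e0.
apply: (@le_trans _ _ ((L (trunc e f))%:E + e%:E)).
  by rewrite -EFinD lee_fin; exact: L_trunc dUf.
by rewrite leeD2r// H.
Qed.

Lemma open_mass0 : open_mass set0 = 0.
Proof.
apply/eqP; rewrite eq_le; apply/andP; split.
  apply: ge_ereal_sup => _ [f [_ _ f0] <-].
  have -> : f = (fun=> 0%R) by apply/funext => w; exact: f0.
  by rewrite L_cst.
by have := dominated_L (dominated_cst0 set0); rewrite L_cst.
Qed.

Lemma open_mass_ge0 U : 0 <= open_mass U.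
Proof. by have := dominated_L (dominated_cst0 U); rewrite L_cst. Qed.

Lemma open_massT : open_mass setT = 1.
Proof.
apply/eqP; rewrite eq_le; apply/andP; split.
  apply: ge_ereal_sup => _ [f [cf f01 _] <-].
  rewrite lee_fin -(L_cst 1); apply: L_le => //; first by move=> ?; exact: cvg_cst.
  by move=> w; case/andP: (f01 w).
have : dominated_by setT (fun=> 1%R).
  by split=> [w|w|w /(_ I)//]; [exact: cvg_cst|rewrite ler01 lexx].
by move=> /dominated_L; rewrite L_cst.
Qed.

Lemma le_open_mass U V : U `<=` V -> open_mass U <= open_mass V.
Proof.
move=> UV; apply: ge_ereal_sup => _ [f [cf f01 f0] <-].
by apply: dominated_L; split=> // w nV; apply: f0 => /UV.
Qed.

(** A partition of unity splits the truncated function into t h and t (1 - h). The second part is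
    dominated by [V]: off [V], either t = 0, outside [K], or h = 1, on K minus V. *)
Lemma open_massU U V : open U -> open V ->
  open_mass (U `|` V) <= open_mass U + open_mass V.
Proof.
move=> oU oV; apply: open_mass_le => e f e0 dUf.
have [[ct t01 _] _ cK sK toff] := truncP e0 dUf.
set K := [set w | _] in cK sK toff; set t := trunc e f in ct t01 toff *.
have [h [ch h01 h1 h0]] : exists h : T -> R, [/\ continuous h,
    forall w, (0 <= h w <= 1)%R, forall w, (K `&` ~` V) w -> h w = 1%R &
    forall w, (~` U) w -> h w = 0%R].
  apply: urysohn_compact => //; last first.
  - apply/seteqP; split=> // w [[Kw nV] nU].
    by case: (sK _ Kw).
  - exact: open_closedC.
  - by apply: closedI => //; exact: open_closedC.
have -> : t = ((fun w => t w * h w) \+ (fun w => t w * (1 - h w)))%R.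
  by apply/funext => w /=; rewrite -mulrDr addrC subrK mulr1.
have c1 : continuous (fun w => t w * h w)%R.
  by move=> w; apply: cvgM; [exact: ct|exact: ch].
have c2 : continuous (fun w => t w * (1 - h w))%R.
  by move=> w; apply: cvgM; [exact: ct|apply: cvgB; [exact: cvg_cst|exact: ch]].
rewrite LD// EFinD; apply: leeD; apply: dominated_L; split=> // w.
- have /andP[? ?] := t01 w; have /andP[? ?] := h01 w.
  by rewrite mulr_ge0//= mulr_ile1.
- by move=> /h0 ->; rewrite mulr0.
- have /andP[? ?] := t01 w; have /andP[? ?] := h01 w.
  by rewrite mulr_ge0 ?subr_ge0//= mulr_ile1 ?subr_ge0// gerBl.
- move=> nV; have [Kw|nK] := pselect (K w); last by rewrite toff// mul0r.
  by rewrite h1// subrr mulr0.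
Qed.

Lemma open_mass_bigcup (U : (set T)^nat) : (forall i, open (U i)) ->
  open_mass (\bigcup_i U i) <= \sum_(i <oo) open_mass (U i).
Proof.
move=> oU; apply: open_mass_le => e f e0 dUf.
have [[ct t01 _] _ cK sK toff] := truncP e0 dUf.
set K := [set w | _] in cK sK toff.
have finU n : open_mass (\bigcup_(i < n) U i) <= \sum_(i < n) open_mass (U i).
  elim: n => [|n IH]; first by rewrite bigcup_mkord !big_ord0 open_mass0.
  rewrite bigcup_mkord !big_ord_recr/=.
  apply: le_trans (open_massU _ (oU n)) _; last by rewrite leeD2r// -bigcup_mkord.
  by rewrite -bigcup_mkord; apply: bigcup_open.
have [n Kn] : exists n, K `<=` \bigcup_(i < n) U i.
  (* The finite unions increase with n and each point of [K] has a neighbourhood inside one of them;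
     covering compactness along [\oo] gives one n for all of [K]. *)
  have kK : compact K by apply: subclosed_compact cT _.
  have /(_ nat \oo (fun n w => (\bigcup_(i < n) U i) w) _)[] :=
      (compact_near_coveringP K).1 kK.
    move=> w /sK [i _ Uiw]; exists (U i, [set n | (i < n)%N]) => /=.
      by split; [exact: open_nbhs_nbhs|exists i.+1].
    by move=> [w' n] /= [? ?]; exists i.
  by move=> N _ HN; exists N; exact: (HN N (leqnn N)).
apply: (@le_trans _ _ (open_mass (\bigcup_(i < n) U i))).
  apply: dominated_L; split=> // w nU; apply: toff => Kw.
  exact/nU/Kn.
apply: le_trans (finU n) _.
rewrite -(big_mkord xpredT (fun i => open_mass (U i))).
by apply: nneseries_lim_ge => *; exact: open_mass_ge0.
Qed.

Lemma open_outer_mass U : open U -> outer_mass U = open_mass U.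
Proof.
move=> oU; apply/eqP; rewrite eq_le; apply/andP; split.
  by apply: ereal_inf_lbound; exists U => //; split.
by apply: le_ereal_inf_tmp => _ [V [_ UV] <-]; exact: le_open_mass.
Qed.

Lemma le_outer_mass : {homo outer_mass : B C / B `<=` C >-> B <= C}.
Proof.
move=> B C BC; apply: le_ereal_inf_tmp => _ [V [oV CV] <-].
apply: ereal_inf_lbound; exists V => //; split=> //.
exact: subset_trans CV.
Qed.

Lemma outer_mass0 : outer_mass set0 = 0.
Proof. by rewrite open_outer_mass ?open_mass0//; exact: open0. Qed.

Lemma outer_mass_ge0 B : 0 <= outer_mass B.
Proof. by apply: le_ereal_inf_tmp => _ [V _ <-]; exact: open_mass_ge0. Qed.

Lemma outer_mass_fin_num B : outer_mass B \is a fin_num.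
Proof.
rewrite ge0_fin_numE ?outer_mass_ge0//.
apply: le_lt_trans (le_outer_mass (subsetT B)) _.
by rewrite open_outer_mass ?open_massT ?ltry//; exact: openT.
Qed.

Lemma outer_mass_adherent B e : (0 < e)%R ->
  exists U, [/\ open U, B `<=` U & open_mass U <= outer_mass B + e%:E].
Proof.
move=> e0; have [_ [U [oU BU] <-] lt] :=
  lb_ereal_inf_adherent e0 (outer_mass_fin_num B).
by exists U; split=> //; exact: ltW.
Qed.

Lemma outer_mass_sigma_subadditive : sigma_subadditive outer_mass.
Proof.
move=> F; apply/lee_addgt0Pr => e e0.
have H n : exists U, [/\ open U, F n `<=` U &
    open_mass U <= outer_mass (F n) + (e / (2 ^ n.+1)%:R)%:E].
  by apply: outer_mass_adherent; rewrite divr_gt0// ltr0n expn_gt0.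
have [U HU] := choice H.
apply: (@le_trans _ _ (open_mass (\bigcup_n U n))).
  apply: ereal_inf_lbound; exists (\bigcup_n U n) => //; split.
    by apply: bigcup_open => i _; have [] := HU i.
  by move=> w [i _ Fw]; exists i => //; have [_ + _] := HU i; apply.
apply: le_trans (open_mass_bigcup _) _; first by move=> i; have [] := HU i.
apply: le_trans (epsilon_trick xpredT _ (ltW e0)); last first.
  by move=> n; exact: outer_mass_ge0.
apply: lee_nneseries => [i _ _|i _]; first exact: open_mass_ge0.
by have [] := HU i.
Qed.

(** If t is truncated for the intersection of V and U, and g is dominated by V minus K, then t and g
    are never both non-zero, so g + t is still dominated by [V]. Removing only the closed set [K]
    from [V] leaves an open set that covers V minus U. *)
Lemma caratheodory_open (U : set T) : open U ->
  forall X, outer_mass (X `&` U) + outer_mass (X `&` ~` U) <= outer_mass X.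
Proof.
move=> oU X; apply: le_ereal_inf_tmp => _ [V [oV XV] <-].
apply: (@le_trans _ _ (outer_mass (V `&` U) + outer_mass (V `&` ~` U))).
  by apply: leeD; apply: le_outer_mass; exact: setSI.
rewrite -leeBrDr ?outer_mass_fin_num// open_outer_mass; last exact: openI.
apply: open_mass_le => e f e0 dUf.
have [[ct t01 tVU] _ cK sK toff] := truncP e0 dUf.
set K := [set w | _] in cK sK toff; set t := trunc e f in ct t01 tVU toff *.
rewrite leeBrDr ?outer_mass_fin_num//.
have oVK : open (V `&` ~` K) by apply: openI => //; exact: closed_openC.
apply: (@le_trans _ _ ((L t)%:E + open_mass (V `&` ~` K))).
  rewrite leeD2l// -open_outer_mass//; apply: le_outer_mass => w [Vw nU].
  by split=> // /sK[].
rewrite addeC -leeBrDr//; apply: ge_ereal_sup => _ [g [cg g01 gVK] <-].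
rewrite leeBrDr// -EFinD -LD//; apply: dominated_L; split=> /=.
- by move=> w; apply: cvgD; [exact: cg|exact: ct].
- move=> w; have [Kw|nK] := pselect (K w).
    by rewrite gVK ?add0r// => -[].
  by rewrite toff// addr0.
- by move=> w nV; rewrite gVK ?tVU ?addr0// => -[].
Qed.

Lemma riesz_measure (x0 : T) : exists mu : probability (borel x0) R,
  regular_measure mu /\ forall U : set T, open U -> mu U = open_mass U.
Proof.
pose mu0 : {outer_measure set (pointed_at x0) -> \bar R} :=
  OuterMeasure.Pack (OuterMeasure.Class (isOuterMeasure.Axioms_ _ _
    outer_mass0 outer_mass_ge0 le_outer_mass outer_mass_sigma_subadditive)).
have borel_cara (B : set (borel x0)) : measurable B -> mu0.-cara.-measurable B.
  apply: smallest_sub; first exact: sigma_algebra_measurable.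
  move=> U oU; apply: le_caratheodory_measurable.
  exact: (caratheodory_open oU).
have mu_sigma : semi_sigma_additive (outer_mass : set (borel x0) -> \bar R).
  move=> F mF tF mUF.
  apply: (@caratheodory_measure_sigma_additive _ _ mu0) => //.
    by move=> i; exact: borel_cara.
  exact: borel_cara.
pose mu1 := isMeasure.Build _ (borel x0) R outer_mass outer_mass0
  outer_mass_ge0 mu_sigma.
pose mu2 : {measure set (borel x0) -> \bar R} := HB.pack outer_mass mu1.
have mu2T : mu2 setT = 1 by rewrite /= open_outer_mass ?open_massT//; exact: openT.
pose mu3 := Measure_isProbability.Build _ (borel x0) R mu2 mu2T.
pose mu : probability (borel x0) R := HB.pack outer_mass mu1 mu3.
exists mu; split; last by move=> U oU; exact: open_outer_mass.
have muE (B : set T) : mu B = outer_mass B by [].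
have measurable_open (U : set T) : open U -> measurable (U : set (borel x0)).
  by move=> oU; exact: sub_sigma_algebra.
move=> B mB; split.
  rewrite muE; congr ereal_inf; apply/seteqP; split=> _ [U [oU BU] <-];
    by exists U => //; rewrite muE open_outer_mass.
apply/eqP; rewrite eq_le; apply/andP; split; last first.
  by apply: ge_ereal_sup => _ [K [_ _ KB] <-]; exact: le_outer_mass.
(* Inner regularity at [B] is outer regularity at its complement: an open [U] containing the
   complement of [B] has a compact complement inside [B]. *)
apply/lee_addgt0Pr => e e0.
have [U [oU BU muU]] := outer_mass_adherent (~` B) e0.
have mU := measurable_open _ oU.
have mUC : measurable (~` U : set (borel x0)) by exact: measurableC.
have HC (C : set (borel x0)) : measurable C -> mu (~` C) = 1 - mu C.
  exact: probability_setC.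
apply: (@le_trans _ _ (mu (~` U) + e%:E)); last first.
  rewrite leeD2r//; apply: ereal_sup_ubound; exists (~` U) => //; split=> //.
    by apply: subclosed_compact cT _ => //; exact: open_closedC.
  by move=> w nU; apply: contrapT => /BU.
have : mu U <= mu (~` B) + e%:E by rewrite !muE open_outer_mass.
rewrite !HC//.
have /fineK <- : mu U \is a fin_num by exact: outer_mass_fin_num.
have /fineK <- : mu B \is a fin_num by exact: outer_mass_fin_num.
by rewrite -!EFinB -!EFinD !lee_fin; lra.
Qed.

End RieszMeasure.

(** * Means over finite lists of times and unique ergodicity *)

Definition time_average (R : realType) (T : Type) (act : R -> T -> T)
    (s : seq R) (f : T -> R) (w : T) : R :=
  (\sum_(t <- s) f (act t w)) / (size s)%:R.

Section UniqueErgodicityFromAverages.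
Variables (R : realType) (T : topologicalType) (act : R -> T -> T).
Hypotheses (cT : compact [set: T]) (hT : hausdorff_space T).
Hypothesis act_continuous : forall t, continuous (act t).
Hypothesis act0 : forall w, act 0 w = w.
Hypothesis actD : forall s t w, act (s + t) w = act s (act t w).
Local Notation avg := (time_average act).

(** Convolution of two lists of times: averaging over it is averaging twice, in either order.
    Approximations obtained from different lists can thus be compared on a common one. *)
Let times (s s' : seq R) : seq R := [seq t + t' | t <- s, t' <- s'].

Let times_gt0 s s' : (0 < size s)%N -> (0 < size s')%N ->
  (0 < size (times s s'))%N.
Proof. by rewrite size_allpairs muln_gt0 => -> ->. Qed.

Let avg_times s s' f w : avg (times s s') f w = avg s' (avg s f) w.
Proof.
rewrite /time_average size_allpairs natrM invfM mulrA.
rewrite big_allpairs_dep exchange_big/=.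
congr (_ * _); rewrite mulr_suml; apply: eq_bigr => t' _; congr (_ * _).
by apply: eq_bigr => t _; rewrite actD.
Qed.

Let timesC s s' f w : avg (times s s') f w = avg (times s' s) f w.
Proof.
rewrite /time_average !size_allpairs mulnC; congr (_ / _).
rewrite !big_allpairs_dep exchange_big/=.
by apply: eq_bigr => t' _; apply: eq_bigr => t _; rewrite addrC.
Qed.

Let le_avg s f a w : (0 < size s)%N -> (forall w, a <= f w) -> a <= avg s f w.
Proof.
move=> s0 af; rewrite /time_average ler_pdivlMr ?ltr0n// -sum1_size natr_sum.
by rewrite mulr_sumr; apply: ler_sum => t _; rewrite mulr1.
Qed.

Let ge_avg s f a w : (0 < size s)%N -> (forall w, f w <= a) -> avg s f w <= a.
Proof.
move=> s0 af; rewrite /time_average ler_pdivrMr ?ltr0n// -sum1_size natr_sum.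
by rewrite mulr_sumr; apply: ler_sum => t _; rewrite mulr1.
Qed.

Let near_mean s f (a e : R) : Prop :=
  (0 < size s)%N /\ forall w, `|avg s f w - a| <= e.

Hypothesis averages : forall f : T -> R, continuous f ->
  forall e : R, 0 < e -> exists s c,
    (0 < size s)%N /\ forall w, `|avg s f w - c| <= e.

Let near_meanl s s' f a e : near_mean s f a e -> (0 < size s')%N ->
  near_mean (times s s') f a e.
Proof.
move=> [s0 H] s'0; split; first exact: times_gt0.
move=> w; rewrite avg_times ler_distl; apply/andP; split.
  by apply: le_avg => // v; have := H v; rewrite ler_distl => /andP[].
by apply: ge_avg => // v; have := H v; rewrite ler_distl => /andP[].
Qed.

Let near_meanr s s' f a e : near_mean s f a e -> (0 < size s')%N ->
  near_mean (times s' s) f a e.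
Proof.
move=> H s'0; have [? H'] := near_meanl H s'0; split.
  by apply: times_gt0 => //; case: H.
by move=> w; rewrite timesC.
Qed.

Variable x0 : T.

Let mean_unique f a b :
  (forall e, 0 < e -> exists s, near_mean s f a e) ->
  (forall e, 0 < e -> exists s, near_mean s f b e) -> a = b.
Proof.
move=> Ha Hb; apply/eqP; rewrite -subr_eq0 -normr_le0.
apply/ler_addgt0Pr => e e0; rewrite add0r.
have e2 : 0 < e / 2 by rewrite divr_gt0.
have [s sa] := Ha _ e2; have [s' sb] := Hb _ e2.
have [_ /(_ x0) H1] := near_meanl sa sb.1.
have [_ /(_ x0) H2] := near_meanr sb sa.1.
move: H1 H2; set v := avg _ _ _ => H1 H2.
rewrite (_ : a - b = (v - b) - (v - a)); last by lra.
by rewrite (le_trans (ler_normB _ _))//; lra.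
Qed.

(** The constants in [averages] depend on [e]. The supremum of all uniform lower bounds of averages
    does not, and by convolving lists every constant for [e] is within [e] of it. *)
Let mean_exists f : continuous f ->
  exists a, forall e, 0 < e -> exists s, near_mean s f a e.
Proof.
move=> cf; pose C := [set c | exists s, (0 < size s)%N /\ forall w, c <= avg s f w].
have Cle c s b e : C c -> near_mean s f b e -> c <= b + e.
  move=> [s' [s'0 H]] [s0 H'].
  have : c <= avg (times s' s) f x0 by rewrite avg_times; apply: le_avg.
  move=> /le_trans; apply; rewrite timesC avg_times; apply: ge_avg => // w.
  by have := H' w; rewrite ler_distl => /andP[].
have Cge s b e : near_mean s f b e -> C (b - e).
  move=> [s0 H]; exists s; split=> // w.
  by have := H w; rewrite ler_distl => /andP[].
have supC : has_sup C.
  have [s [b H]] := averages cf ltr01.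
  by split; [exists (b - 1); exact: Cge H|exists (b + 1) => c Cc; exact: Cle H].
exists (sup C) => e e0; have e2 : 0 < e / 2 by rewrite divr_gt0.
have [s [b H]] := averages cf e2; exists s; split; first by case: H.
have h1 : sup C <= b + e / 2.
  by apply: ge_sup; [case: supC|move=> c Cc; exact: Cle H].
have h2 : b - e / 2 <= sup C by apply: sup_upper_bound => //; exact: Cge H.
move=> w; have [_ /(_ w)] := H; rewrite !ler_distl => /andP[h3 h4].
by apply/andP; split; lra.
Qed.

Let mean (f : T -> R) : R :=
  xget 0 [set a | forall e, 0 < e -> exists s, near_mean s f a e].

Let meanP f : continuous f ->
  forall e, 0 < e -> exists s, near_mean s f (mean f) e.
Proof.
move=> /mean_exists [a Ha].
exact: (@xgetPex _ 0 [set a | forall e, 0 < e -> exists s, near_mean s f a e]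
  (ex_intro _ a Ha)).
Qed.

Let meanE f a : continuous f ->
  (forall e, 0 < e -> exists s, near_mean s f a e) -> mean f = a.
Proof. by move=> cf; apply: mean_unique; exact: meanP. Qed.

Let meanD f g : continuous f -> continuous g ->
  mean (f \+ g) = mean f + mean g.
Proof.
move=> cf cg; apply: meanE => [w|e e0].
  by apply: cvgD; [exact: cf|exact: cg].
have e2 : 0 < e / 2 by rewrite divr_gt0.
have [s sf] := meanP cf e2; have [s' sg] := meanP cg e2.
exists (times s s').
have [u0 uf] := near_meanl sf sg.1; have [_ ug] := near_meanr sg sf.1.
split=> // w; have := uf w; have := ug w.
have -> : avg (times s s') (f \+ g) w =
    avg (times s s') f w + avg (times s s') g w.
  by rewrite /time_average -mulrDl big_split.
move=> h1 h2; rewrite opprD addrACA (le_trans (ler_normD _ _))//; lra.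
Qed.

Let mean_le f g : continuous f -> continuous g -> (forall w, f w <= g w) ->
  mean f <= mean g.
Proof.
move=> cf cg fg; apply/ler_addgt0Pr => e e0.
have e2 : 0 < e / 2 by rewrite divr_gt0.
have [s sf] := meanP cf e2; have [s' sg] := meanP cg e2.
have [_ /(_ x0) uf] := near_meanl sf sg.1.
have [_ /(_ x0) ug] := near_meanr sg sf.1.
have : avg (times s s') f x0 <= avg (times s s') g x0.
  by rewrite /time_average ler_wpM2r ?invr_ge0//; apply: ler_sum => t _.
by move: uf ug; rewrite !ler_distl => /andP[? ?] /andP[? ?] ?; lra.
Qed.

Let mean_cst (c : R) : mean (fun=> c) = c.
Proof.
apply: meanE => [w|e e0]; first exact: cvg_cst.
exists [:: 0]; split=> // w.
by rewrite /time_average big_seq1 divr1 subrr normr0 ltW.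
Qed.

(** Averaging commutes with the flow, so the list that works for [f] works for its translate: the
    uniform bound is read at another point. *)
Let mean_act f t : continuous f -> mean (f \o act t) = mean f.
Proof.
move=> cf; apply: meanE => [w|e e0].
  by apply: continuous_comp; [exact: act_continuous|exact: cf].
have [s [s0 H]] := meanP cf e0; exists s; split=> // w.
have -> : avg s (f \o act t) w = avg s f (act t w) => //.
by congr (_ / _); apply: eq_bigr => t' _; rewrite /= -!actD addrC.
Qed.

Let act_measurable t (B : set (borel x0)) : measurable B ->
  measurable (act t @^-1` B : set (borel x0)).
Proof.
move: B; apply: smallest_sub.
  split=> /=.
  - by rewrite preimage_set0.
  - move=> B mB; rewrite setTD -preimage_setC; exact: measurableC.
  - by move=> F mF; rewrite preimage_bigcup; exact: bigcup_measurable.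
move=> U oU; apply: sub_sigma_algebra.
by apply: (@open_comp T T) => // w _; exact: act_continuous.
Qed.

Local Open Scope ereal_scope.

(** By invariance, the sum of the indicators along [s] has integral [size s] times [mu B]; a
    pointwise bound on the number of visits to [B] therefore bounds its measure. *)
Let measure_le_average (mu : probability (borel x0) R) (s : seq R)
    (B : set (borel x0)) (b : R) :
  invariant_measure act mu -> (0 < size s)%N -> measurable B ->
  (forall w, \sum_(t <- s) \1_B (act t w) <= (size s)%:R * b)%R ->
  mu B <= b%:E.
Proof.
move=> inv s0 mB sb; set n := (size s)%:R%R : R.
have n0 : (0 < n)%R by rewrite ltr0n.
have mBt t : measurable (act t @^-1` B : set (borel x0)) by exact: act_measurable.
have : \int[mu]_(w in setT) (\sum_(t <- s) (\1_(act t @^-1` B) w)%:E) <=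
    \int[mu]_(w in setT) (n * b)%:E.
  apply: ge0_le_integral => //.
  - by move=> w _; apply: sume_ge0 => t _; rewrite lee_fin.
  - apply: emeasurable_sum => t; apply/measurable_EFinP.
    exact: measurable_indic.
  - by move=> w _; rewrite sumEFin lee_fin; exact: sb.
rewrite ge0_integral_sum//; last first.
  by move=> t; apply/measurable_EFinP; exact: measurable_indic.
have -> : \int[mu]_(w in setT) (n * b)%:E = (n * b)%:E.
  by rewrite integral_cst// [X in _ * X]probability_setT mule1.
rewrite (eq_bigr (fun=> mu B)); last first.
  by move=> t _; rewrite integral_indic// setIT; exact: inv.
have /fineK <- : mu B \is a fin_num by exact: fin_num_measure.
rewrite sumEFin lee_fin big_const_seq count_predT iter_addr_0 -mulr_natl.
by rewrite ler_pM2l.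
Qed.

Lemma uniquely_ergodic_of_averages : uniquely_ergodic act.
Proof.
have [mu [regmu muU]] := riesz_measure cT hT meanD mean_le mean_cst x0.
have dominated_act t (U : set T) f : dominated_by U f ->
    dominated_by (act t @^-1` U) (f \o act t).
  move=> [cf f01 f0]; split=> [w|w|w] /=; [|exact: f01|exact: f0].
  by apply: continuous_comp; [exact: act_continuous|exact: cf].
have le_act t (U : set T) : open_mass mean U <= open_mass mean (act t @^-1` U).
  apply: ge_ereal_sup => _ [f dUf <-].
  have [cf _ _] := dUf; rewrite -(mean_act t cf).
  by apply: ereal_sup_ubound; exists (f \o act t) => //; exact: dominated_act.
have actK t (B : set T) : act (- t) @^-1` (act t @^-1` B) = B.
  by apply/seteqP; split=> w /=; rewrite -actD subrr act0.
have invU t (U : set T) : open_mass mean (act t @^-1` U) = open_mass mean U.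
  apply/eqP; rewrite eq_le le_act andbT.
  by have := le_act (- t)%R (act t @^-1` U); rewrite actK.
(* Outer regularity carries invariance from open sets to Borel sets; the reverse inequality is this
   one for [- t]. *)
have inv_le t (B : set (borel x0)) : measurable B -> mu (act t @^-1` B) <= mu B.
  move=> mB; rewrite [leRHS](regmu _ mB).1.
  apply: le_ereal_inf_tmp => _ [U [oU BU] <-].
  rewrite [leRHS]muU// -(invU t) -muU; last first.
    by apply: open_comp => // w _; exact: act_continuous.
  apply: le_measure; rewrite ?inE; last by move=> w; exact: BU.
    exact: act_measurable.
  by apply: act_measurable; exact: sub_sigma_algebra.
exists x0, mu; split=> //.
  move=> t B mB; apply/eqP; rewrite eq_le inv_le//=.
  have := inv_le (- t)%R (act t @^-1` B) (act_measurable _ mB).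
  by rewrite actK.
(* Regularity reduces the comparison to a compact [K] inside an open [U]. A Urysohn function between
   them has averages near one constant c, whence mu1 K <= c + e/2 and mu2 U >= c - e/2; exchanging
   the measures gives equality. *)
have cmp (mu1 mu2 : probability (borel x0) R) :
    invariant_measure act mu1 -> regular_measure mu1 ->
    invariant_measure act mu2 -> regular_measure mu2 ->
    forall B : set (borel x0), measurable B -> mu1 B <= mu2 B.
  move=> inv1 reg1 inv2 reg2 B mB.
  rewrite (reg1 _ mB).2 (reg2 _ mB).1.
  apply: ge_ereal_sup => _ [K [cK mK KB] <-].
  apply: le_ereal_inf_tmp => _ [U [oU BU] <-].
  have mU : measurable (U : set (borel x0)) by exact: sub_sigma_algebra.
  have [f [cf f01 f1 f0]] : exists f : T -> R, [/\ continuous f,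
      forall w, (0 <= f w <= 1)%R, forall w, K w -> f w = 1%R &
      forall w, (~` U) w -> f w = 0%R].
    apply: urysohn_compact => //; first exact: compact_closed.
      exact: open_closedC.
    by apply/seteqP; split=> // w [/KB/BU].
  apply/lee_addgt0Pr => e e0; have e2 : (0 < e / 2)%R by rewrite divr_gt0.
  have [s [c [s0 H]]] := averages cf e2.
  have ns : (0 < (size s)%:R :> R)%R by rewrite ltr0n.
  have h1 : mu1 K <= (c + e / 2)%:E.
    apply: measure_le_average inv1 s0 mK _ => w.
    have := H w; rewrite ler_distl => /andP[_].
    rewrite ler_pdivrMr// mulrC; apply: le_trans; apply: ler_sum => t _.
    rewrite indicE; have [Kt|nKt] := boolP (act t w \in K).
      by rewrite f1//; exact: set_mem.
    by case/andP: (f01 (act t w)).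
  (* [measure_le_average] bounds from above only, so [U] is bounded from below through its
     complement and 1 - f. *)
  have h2 : mu2 (~` U) <= (1 - (c - e / 2))%:E.
    apply: measure_le_average inv2 s0 (measurableC mU) _ => w.
    have := H w; rewrite ler_distl => /andP[+ _].
    rewrite ler_pdivlMr// mulrC => h.
    apply: (@le_trans _ _ (\sum_(t <- s) (1 - f (act t w)))%R).
      apply: ler_sum => t _; rewrite indicE.
      have [Ut|nUt] := boolP (act t w \in ~` U).
        by rewrite f0 ?subr0//; exact: set_mem.
      by rewrite subr_ge0; case/andP: (f01 (act t w)).
    rewrite sumrB big_const_seq count_predT iter_addr_0 [leRHS]mulrBr mulr1.
    by rewrite lerD2l lerN2.
  apply: le_trans h1 _; move: h2; rewrite probability_setC//.
  have /fineK <- : mu2 U \is a fin_num by exact: fin_num_measure.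
  by rewrite -EFinB -EFinD !lee_fin; lra.
move=> nu invnu regnu B mB; apply/eqP; rewrite eq_le.
have invmu : invariant_measure act mu.
  move=> t C mC; apply/eqP; rewrite eq_le inv_le//=.
  have := inv_le (- t)%R (act t @^-1` C) (act_measurable _ mC).
  by rewrite actK.
by rewrite !cmp.
Qed.

End UniqueErgodicityFromAverages.

(** * Words and substitutions *)

Lemma cvg_bigsum (K : numFieldType) (I T : Type) (F : set_system T)
    {FF : Filter F} (r : seq I) (f : I -> T -> K) (l : I -> K) :
  (forall i, f i @ F --> l i) ->
  (fun t => \sum_(i <- r) f i t) @ F --> \sum_(i <- r) l i.
Proof.
move=> fl; elim: r => [|i r IH].
  rewrite big_nil; under eq_fun do rewrite big_nil.
  exact: cvg_cst.
rewrite big_cons; under eq_fun do rewrite big_cons.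
by apply: cvgD; [exact: fl|exact: IH].
Qed.

Lemma near_eq_continuous (T U : topologicalType) (f g : T -> U) (t : T) :
  (\forall x \near t, f x = g x) -> {for t, continuous g} ->
  {for t, continuous f}.
Proof.
move=> fg cg; rewrite /prop_for /continuous_at (nbhs_singleton fg).
by apply: cvg_trans cg; apply: near_eq_cvg; near=> x; rewrite (near fg x).
Unshelve. all: by end_near. Qed.

Section WordTopology.
Variable A : topologicalType.

Lemma cvg_ptws (I : eqType) (T : Type) (F : set_system T) (g : T -> {ptws I -> A})
    (h : {ptws I -> A}) : Filter F ->
  (forall i, (fun t => g t i) @ F --> h i) -> g @ F --> h.
Proof.
move=> FF gh; apply/cvg_sup => i U [V [[W oW <-] Whi] VU].
apply: (filterS VU); rewrite nbhs_simpl; apply: (gh i).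
exact: open_nbhs_nbhs.
Qed.

Lemma continuous_ptws (I : eqType) (T : topologicalType) (g : T -> {ptws I -> A}) :
  (forall i, continuous (fun t => g t i)) -> continuous g.
Proof. by move=> cg t; apply: cvg_ptws => i; exact: cg. Qed.

Lemma ptws_continuous (I : eqType) (i : I) : continuous (fun g : {ptws I -> A} => g i).
Proof. exact: (@proj_continuous I (fun=> A) i). Qed.

Definition word_of n (v : {ptws 'I_n -> A}) : word A := [seq v i | i <- enum 'I_n].

Let word_sig_cast n (u : seq A) (e : size u = n) :
  word_sig u = existT (fun n => {ptws 'I_n -> A}) n
    (fun i => tnth (in_tuple u) (cast_ord (esym e) i)).
Proof.
by case: _ / e; congr existT; apply/funext => i; congr tnth; apply: val_inj.
Qed.

Lemma word_sig_of n (v : {ptws 'I_n -> A}) :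
  word_sig (word_of v) = existT (fun n => {ptws 'I_n -> A}) n v.
Proof.
have e : size (word_of v) = n by rewrite size_map size_enum_ord.
rewrite (word_sig_cast e); congr existT; apply/funext => i.
rewrite (tnth_nth (v i)) /= (nth_map i) ?size_enum_ord//.
by rewrite nth_ord_enum.
Qed.

Lemma word_of_continuous n : continuous (@word_of n).
Proof.
apply: (@continuous_comp_initial _ _ _ (@word_sig A)).
have -> : word_sig (A:=A) \o @word_of n = existT (fun n => {ptws 'I_n -> A}) n.
  by apply/funext => v /=; rewrite word_sig_of.
exact: existT_continuous.
Qed.

Let word_ofK (u : word A) : word_of (projT2 (word_sig u)) = u.
Proof. exact: (map_tnth_enum (in_tuple u)). Qed.

(** [word_sig] presents words as the topological sum of the powers of [A], and continuity on a sum
    is continuity on each summand. *)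
Lemma word_continuousP (T : topologicalType) (g : word A -> T) :
  (forall n, continuous (fun v : {ptws 'I_n -> A} => g (word_of v))) -> continuous g.
Proof.
move=> cg; have -> : g = sigT_fun (fun n v => g (@word_of n v)) \o @word_sig A.
  by apply/funext => u /=; rewrite /sigT_fun word_ofK.
move=> u; apply: continuous_comp; first exact: initial_continuous.
exact: (@sigT_continuous _ (fun n => {ptws 'I_n -> A}) T (fun n v => g (@word_of n v))).
Qed.

Lemma size_near (u : word A) : \forall u' \near u, size u' = size u.
Proof.
have : continuous (size : word A -> nat).
  apply: word_continuousP => n.
  rewrite (_ : (fun _ => _) = (fun=> n)).
    exact: cst_continuous.
  by apply/funext => v; rewrite size_map size_enum_ord.
move=> /(_ u [set m | m = size u]); apply.
by apply: open_nbhs_nbhs; split=> //; exact: discrete_open.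
Qed.

Lemma nth_word_continuous (x0 : A) i : continuous (fun u : word A => nth x0 u i).
Proof.
apply: word_continuousP => n; have [lt_in|le_ni] := ltnP i n; last first.
  rewrite (_ : (fun _ => _) = (fun=> x0)); first exact: cst_continuous.
  by apply/funext => v; rewrite nth_default// size_map size_enum_ord.
rewrite (_ : (fun _ => _) = (fun v => v (Ordinal lt_in))).
  exact: (@ptws_continuous 'I_n).
apply/funext => v; rewrite (nth_map (Ordinal lt_in)) ?size_enum_ord//.
by congr (v _); apply: val_inj; rewrite /= nth_enum_ord.
Qed.

(** Near [t] all values lie in a single summand, where convergence is letter by letter: the map
    agrees there with [word_of] applied to its letters. *)
Lemma cvg_word (x0 : A) (T : topologicalType) (g : T -> word A) t :
  (\forall t' \near t, size (g t') = size (g t)) ->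
  (forall i, {for t, continuous (fun t' => nth x0 (g t') i)}) ->
  {for t, continuous g}.
Proof.
move=> szg cg; set n := size (g t) in szg.
pose h t' : {ptws 'I_n -> A} := fun i => nth x0 (g t') i.
have gE t' : size (g t') = n -> word_of (h t') = g t'.
  move=> szt'; apply: (@eq_from_nth _ x0); first by rewrite size_map size_enum_ord.
  move=> i; rewrite size_map size_enum_ord => lt_in.
  by rewrite (nth_map (Ordinal lt_in)) ?size_enum_ord// /h nth_enum_ord.
have ch : {for t, continuous (@word_of n \o h)}.
  apply: continuous_comp; last exact: word_of_continuous.
  by apply: cvg_ptws => i; exact: cg.
apply: near_eq_continuous ch; near=> t'.
by rewrite /= gE//; near: t'.
Unshelve. all: by end_near. Qed.

Lemma near_all_nat (T : Type) (F : set_system T) {FF : Filter F}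
    (P : nat -> T -> Prop) n :
  (forall i, (i < n)%N -> \forall t \near F, P i t) ->
  \forall t \near F, forall i, (i < n)%N -> P i t.
Proof.
elim: n => [|n IH] H; first by near=> t.
have /IH Hn : forall i, (i < n)%N -> \forall t \near F, P i t.
  by move=> i lin; apply: H; exact: ltnW.
have Pn := H n (ltnSn n).
near=> t => i; rewrite ltnS leq_eqVlt => /orP[/eqP ->|].
  by near: t.
by move: i; near: t.
Unshelve. all: by end_near. Qed.

(** Near [u] the lengths of the blocks do not change, so the i-th letter of the image is always the
    letter of offset [c] in the block of index [r], with [r] and [c] fixed. *)
Lemma subst_word_continuous (rho : substitution A) :
  continuous (subst_word rho : word A -> word A).
Proof.
(* [nth] needs a default letter; over an empty alphabet the only word is the empty one. *)
have [[x0 _]|noA] := pselect (exists x0 : A, True); last first.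
  move=> u; have E (u' : word A) : u' = [::].
    by case: u' => // a; case: noA; exists a.
  rewrite (_ : subst_word rho = id); first exact: cvg_id.
  by apply/funext => u'; rewrite [LHS]E [RHS]E.
pose ss (u : word A) := [seq rho a | a <- u].
move=> u; have shape_near : \forall u' \near u, shape (ss u') = shape (ss u).
  have cr i : continuous (fun u' : word A => rho (nth x0 u' i) : word A).
    move=> u'.
    apply: (@continuous_comp (word A) A (word A) (fun v => nth x0 v i) rho).
      exact: nth_word_continuous.
    exact: subst_continuous.
  have szr : \forall u' \near u, forall i, (i < size u)%N ->
      size (rho (nth x0 u' i)) = size (rho (nth x0 u i)).
    apply: (@near_all_nat _ (nbhs u) _
      (fun i (u' : word A) => size (rho (nth x0 u' i)) = size (rho (nth x0 u i)))).
    by move=> i _; exact: (cr i u _ (size_near _)).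
  near=> u'; have szu : size u' = size u by near: u'; exact: size_near.
  apply: (@eq_from_nth _ 0%N); first by rewrite !size_map szu.
  have szr' i : (i < size u)%N ->
      size (rho (nth x0 u' i)) = size (rho (nth x0 u i)) by move: i; near: u'.
  move=> i; rewrite !size_map => lti.
  have ltiu : (i < size u)%N by rewrite -szu.
  by rewrite !(nth_map [::]) ?size_map// !(nth_map x0)// szr'.
apply: (@cvg_word x0 (word A) (subst_word rho) u) => [|i].
  near=> u'; rewrite !size_flatten; congr sumn.
  by near: u'; exact: shape_near.
set r := reshape_index (shape (ss u)) i.
set c := reshape_offset (shape (ss u)) i.
have cr : {for u, continuous (fun u' => nth x0 (nth [::] (ss u') r) c)}.
  have [ltr|ler] := ltnP r (size u); last first.
    have H u' : size u' = size u -> nth x0 (nth [::] (ss u') r) c = x0.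
      by move=> e; rewrite [nth [::] _ _]nth_default ?size_map ?e// nth_nil.
    apply: (@near_eq_continuous (word A) A _ (fun=> x0) u); last exact: cst_continuous.
    by near=> u'; apply: H; near: u'; exact: size_near.
  have ch : {for u, continuous (fun u' : word A => nth x0 (rho (nth x0 u' r)) c)}.
    apply: (@continuous_comp (word A) (word A) A
      (fun u' : word A => rho (nth x0 u' r)) (fun v => nth x0 v c));
      last exact: nth_word_continuous.
    apply: (@continuous_comp (word A) A (word A) (fun v => nth x0 v r) rho).
      exact: nth_word_continuous.
    exact: subst_continuous.
  apply: near_eq_continuous ch; near=> u'; rewrite (nth_map x0)//.
  by have -> : size u' = size u by near: u'; exact: size_near.
apply: near_eq_continuous cr; near=> u'; rewrite nth_flatten.
have -> // : shape (ss u') = shape (ss u).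
by near: u'; exact: shape_near.
Unshelve. all: by end_near. Qed.

Lemma iter_subst_continuous (rho : substitution A) n :
  continuous (fun a => iter n (subst_word rho) [:: a] : word A).
Proof.
elim: n => [|n IH] a /=; last first.
  apply: (@continuous_comp A (word A) (word A) _ (subst_word rho)); first exact: IH.
  exact: subst_word_continuous.
apply: (@cvg_word a A (fun a => [:: a]) a); first by near=> b.
case=> [|i] /=; first exact: cvg_id.
rewrite (_ : (fun _ => _) = (fun=> a)); first exact: cvg_cst.
by apply/funext => b; rewrite nth_default.
Unshelve. all: by end_near. Qed.

Lemma sum_word_continuous (K : numFieldType) (p : nat -> word A -> K) :
  (forall i, continuous (p i)) ->
  continuous (fun u : word A => \sum_(i < size u) p i u).
Proof.
move=> cp u; have cs : {for u, continuous (fun u' => \sum_(i < size u) p i u')}.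
  by apply: (@cvg_bigsum K _ _ (nbhs u) (nbhs_filter u)) => i; exact: cp.
apply: near_eq_continuous cs; near=> u'.
by have -> : size u' = size u by near: u'; exact: size_near.
Unshelve. all: by end_near. Qed.

Lemma sum_letters_continuous (K : numFieldType) (f : A -> K) : continuous f ->
  continuous (fun u : word A => \sum_(a <- u) f a).
Proof.
move=> cf.
have [[x0 _]|noA] := pselect (exists x0 : A, True); last first.
  rewrite (_ : (fun _ => _) = (fun=> 0)); first exact: cst_continuous.
  by apply/funext => -[|a u]; [rewrite big_nil|case: noA; exists a].
rewrite (_ : (fun _ => _) =
    (fun u : word A => \sum_(i < size u) f (nth x0 u i))); last first.
  by apply/funext => u; rewrite (big_nth x0) big_mkord.
apply: (@sum_word_continuous K (fun i u => f (nth x0 u i))) => i u.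
apply: (@continuous_comp (word A) A K (fun v => nth x0 v i) f);
  [exact: nth_word_continuous|exact: cf].
Qed.

Lemma subst_op_continuous (K : numFieldType) (rho : substitution A) (f : A -> K) :
  continuous f -> continuous (subst_op rho f).
Proof.
move=> cf a.
apply: (@continuous_comp A (word A) K rho (fun u => \sum_(a <- u) f a)).
  exact: subst_continuous.
exact: sum_letters_continuous.
Qed.

End WordTopology.

(** * Iterates of the substitution and powers of the operator *)

Section SubstitutionIteration.
Variables (A : topologicalType) (rho : substitution A).
Local Notation subst_iter k a := (iter k (subst_word rho) [:: a]).

Lemma subst_word_cat u v : subst_word rho (u ++ v) = subst_word rho u ++ subst_word rho v.
Proof. by rewrite /subst_word map_cat flatten_cat. Qed.

Lemma iter_subst_flatten k u :
  iter k (subst_word rho) u = flatten [seq subst_iter k a | a <- u].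
Proof.
elim: u => [|a u IH] /=; first by elim: k => //= k ->.
by rewrite -IH -cat1s; elim: k {IH} => //= k ->; rewrite subst_word_cat.
Qed.

Lemma iter_substD k n a :
  subst_iter (k + n) a = flatten [seq subst_iter k b | b <- subst_iter n a].
Proof. by rewrite iterD iter_subst_flatten. Qed.

Lemma iter_subst_op (V : nmodType) k (f : A -> V) a :
  iter k (@subst_op A rho V) f a = \sum_(b <- subst_iter k a) f b.
Proof.
elim: k f => [|k IH] f; first by rewrite big_seq1.
rewrite iterSr IH -[k.+1]add1n iter_substD big_flatten big_map.
apply: eq_bigr => b _.
by rewrite /= /subst_word /= cats0.
Qed.

End SubstitutionIteration.

(** * The spectral radius *)

Section ComplexFunctions.
Variable R : realType.
Local Notation Re := complex.Re.
Local Notation Im := complex.Im.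
Implicit Types (x y : R) (z : R[i]).

Lemma norm_real_complex x : `|x%:C%C| = `|x|%:C%C :> R[i].
Proof. by rewrite normc_def /= expr0n addr0 sqrtr_sqr. Qed.

(** The modulus on [R[i]] takes values in [R[i]]; its [Re] is the real number used in estimates. *)
Lemma norm_ReE z : `|z| = (Re `|z|)%:C%C.
Proof. by rewrite normc_def. Qed.

Lemma Re_norm_ge0 z : 0 <= Re `|z|.
Proof. by rewrite normc_def sqrtr_ge0. Qed.

Lemma norm_Re_le z : `|Re z| <= Re `|z|.
Proof. by have := normc_ge_Re z; rewrite norm_ReE lecR. Qed.

Lemma norm_Im_le z : `|Im z| <= Re `|z|.
Proof.
rewrite normc_def /= -sqrtr_sqr ler_sqrt ?addr_ge0 ?sqr_ge0//.
by rewrite lerDr sqr_ge0.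
Qed.

Lemma Re_norm_le z : Re `|z| <= `|Re z| + `|Im z|.
Proof.
rewrite -lecR -norm_ReE {1}[z]complexE (le_trans (ler_normD _ _))//.
rewrite normrM !norm_real_complex (_ : `|'i%C| = 1) ?mul1r ?rmorphD//.
by rewrite normc_def /= expr0n add0r expr1n sqrtr1.
Qed.

Lemma ReMl x z : Re (x%:C%C * z) = x * Re z.
Proof. by case: z => a b /=; rewrite mul0r subr0. Qed.

Lemma ReB z w : Re (z - w) = Re z - Re w.
Proof. exact: raddfB. Qed.

Lemma Re_sum (I : Type) (s : seq I) (f : I -> R[i]) :
  Re (\sum_(i <- s) f i) = \sum_(i <- s) Re (f i).
Proof. exact: raddf_sum. Qed.

Lemma real_complex_continuous (T : topologicalType) (f : T -> R) :
  continuous f -> continuous (fun t => (f t)%:C%C : (R[i] : numFieldType)).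
Proof.
move=> cf t; apply/cvgrPdist_lt => e e0.
have /complex_realP[d dE] : e \is Num.real by exact: gtr0_real.
rewrite dE ltcR in e0 *; move/cvgrPdist_lt: (cf t) => /(_ d e0).
by apply: filterS => u; rewrite -rmorphB norm_real_complex ltcR.
Qed.

Lemma Re_continuous (T : topologicalType) (f : T -> (R[i] : numFieldType)) :
  continuous f -> continuous (fun t => Re (f t)).
Proof.
move=> cf t; apply/cvgrPdist_lt => e e0.
move/cvgrPdist_lt: (cf t) => /(_ e%:C%C); rewrite ltcR => /(_ e0).
apply: filterS => u; rewrite norm_ReE ltcR; apply: le_lt_trans.
by rewrite -raddfB norm_Re_le.
Qed.

(** With k = D / (1 - q) one has k = D + k q, so the intervals of radius k q^n around v n are
    nested; the supremum of their left ends lies in all of them. *)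
Lemma geometric_cauchy (v : nat -> R) (D q : R) : 0 <= q < 1 ->
  (forall n, `|v n.+1 - v n| <= D * q ^+ n) ->
  exists l, forall n, `|l - v n| <= D / (1 - q) * q ^+ n.
Proof.
move=> /andP[q0 q1] Hv; set k := D / (1 - q).
have D0 : 0 <= D by have := Hv 0%N; rewrite expr0 mulr1; apply: le_trans.
have q10 : 0 < 1 - q by rewrite subr_gt0.
have kD : k = D + k * q by rewrite /k; field; rewrite subr_eq0 gt_eqF.
have k0 : 0 <= k by rewrite divr_ge0 // ltW.
have step n : v n - k * q ^+ n <= v n.+1 - k * q ^+ n.+1 /\
    v n.+1 + k * q ^+ n.+1 <= v n + k * q ^+ n.
  have e : k * q ^+ n = D * q ^+ n + k * q ^+ n.+1.
    by rewrite {1}kD mulrDl -mulrA -exprS.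
  have := Hv n; rewrite ler_distl => /andP[h1 h2].
  by split; lra.
have low : {homo (fun n => v n - k * q ^+ n) : m n / (m <= n)%N >-> m <= n}.
  by apply: homo_leq => [x|x y z|n]; [exact: lexx|exact: le_trans|exact: (step n).1].
have upp : {homo (fun n => - (v n + k * q ^+ n)) : m n / (m <= n)%N >-> m <= n}.
  apply: homo_leq => [x|x y z|n]; [exact: lexx|exact: le_trans|].
  by rewrite lerN2; exact: (step n).2.
have low_upp m n : v m - k * q ^+ m <= v n + k * q ^+ n.
  have := low _ _ (leq_maxl m n); have := upp _ _ (leq_maxr m n).
  have := mulr_ge0 k0 (exprn_ge0 (maxn m n) q0); rewrite lerN2 /=.
  by move=> *; lra.
pose C := [set x | exists n, x = v n - k * q ^+ n].
have supC : has_sup C.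
  split; first by exists (v 0%N - k * q ^+ 0); exists 0%N.
  by exists (v 0%N + k * q ^+ 0) => _ [n ->].
exists (sup C) => n; rewrite ler_distl; apply/andP; split.
  by apply: sup_upper_bound => //; exists n.
by apply: ge_sup; [case: supC|move=> _ [m ->]].
Qed.

Lemma complex_geometric_cauchy (u : nat -> R[i]) (D q : R) : 0 <= q < 1 ->
  (forall n, `|u n.+1 - u n| <= (D * q ^+ n)%:C%C) ->
  exists l, forall n, `|l - u n| <= (2 * (D / (1 - q)) * q ^+ n)%:C%C.
Proof.
move=> q01 Hu.
have Hu' n : Re `|u n.+1 - u n| <= D * q ^+ n by rewrite -lecR -norm_ReE.
have HRe n : `|Re (u n.+1) - Re (u n)| <= D * q ^+ n.
  by rewrite -raddfB (le_trans (norm_Re_le _)).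
have HIm n : `|Im (u n.+1) - Im (u n)| <= D * q ^+ n.
  by rewrite -raddfB (le_trans (norm_Im_le _)).
have [x Hx] := geometric_cauchy q01 HRe; have [y Hy] := geometric_cauchy q01 HIm.
exists (x +i* y)%C => n; rewrite norm_ReE lecR (le_trans (Re_norm_le _))//.
by rewrite !raddfB /= -mulrA mulr_natl mulr2n lerD.
Qed.

End ComplexFunctions.

(** * Positivity and the resolvent on the real axis *)

Section NonnegativeOperator.
Variables (R : realType) (A : topologicalType) (rho : substitution A).
Hypotheses (cA : compact [set: A]) (a0 : A).
Local Notation C := (R[i] : numFieldType).

Lemma compact_min (f : A -> R) : continuous f -> exists a, forall b, f a <= f b.
Proof.
move=> cf; have A0 : [set: A] !=set0 by exists a0.
have [c _ H] := compact_EVT_min A0 cA (continuous_subspaceT cf).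
by exists c => b; apply: H; rewrite inE.
Qed.

Lemma compact_max (f : A -> R) : continuous f -> exists a, forall b, f b <= f a.
Proof.
move=> cf; have A0 : [set: A] !=set0 by exists a0.
have [c _ H] := compact_EVT_max A0 cA (continuous_subspaceT cf).
by exists c => b; apply: H; rewrite inE.
Qed.

Lemma compact_norm_bound (f : A -> R) : continuous f ->
  exists2 c : R, 0 <= c & forall a, `|f a| <= c.
Proof.
move=> cf; have [a Ha] := compact_max (f := fun a => `|f a|)
  (fun a => cvg_norm (cf a)).
by exists `|f a|.
Qed.

Lemma subst_opD (K : numFieldType) (f g : A -> K) a :
  subst_op rho (fun a => f a + g a) a = subst_op rho f a + subst_op rho g a.
Proof. exact: big_split. Qed.

Lemma subst_opZ (K : numFieldType) (x : K) (f : A -> K) a :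
  subst_op rho (fun a => x * f a) a = x * subst_op rho f a.
Proof. by rewrite /subst_op mulr_sumr. Qed.

Lemma subst_op_cst (K : numFieldType) (x : K) a :
  subst_op rho (fun=> x) a = x *+ size (rho a).
Proof. by rewrite /subst_op big_const_seq count_predT iter_addr_0. Qed.

Lemma subst_op_le (f g : A -> R) a : (forall b, f b <= g b) ->
  subst_op rho f a <= subst_op rho g a.
Proof. by move=> fg; apply: ler_sum => b _. Qed.

Lemma size_subst_gt0 a : (0 < size (rho a))%N.
Proof. by have := subst_nonempty rho a; case: (rho a). Qed.




(** M has real coefficients, so the real part of the complex solution of (t - M) h = 1 solves it as
    well; the complex resolvent applied to t f - M f returns f and so bounds it. *)
Lemma resolvent_real (t : R) :
  resolvent_set (@subst_op A rho C) (t%:C%C : C) ->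
  (exists h : A -> R, continuous h /\ forall a, t * h a - subst_op rho h a = 1) /\
  exists2 k : R, 0 <= k & forall (f : A -> R) (c : R), continuous f ->
    (forall a, `|t * f a - subst_op rho f a| <= c) -> forall a, `|f a| <= k * c.
Proof.
move=> [S [Scont Slin [k Sk]] Sinv].
have c1 : continuous (fun _ : A => 1 : C) by move=> ?; exact: cvg_cst.
split.
  exists (fun a => complex.Re (S (fun=> 1) a)); split.
    by apply: Re_continuous; exact: Scont.
  move=> a; have [_ /(congr1 (fun f => complex.Re (f a)))] := Sinv _ c1.
  rewrite ReB ReMl => H; apply: etrans (H); congr (_ - _).
  by rewrite /subst_op Re_sum.
have bnd (f : A -> R) (c : R) : continuous f -> (forall a, `|f a| <= c) ->
    forall a, complex.Re `|S (fun a => (f a)%:C%C) a| <= complex.Re k * c.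
  move=> cf fc a.
  have := Sk (fun a => (f a)%:C%C) c%:C%C (real_complex_continuous cf).
  have Hf b : `|(f b)%:C%C| <= c%:C%C by rewrite norm_real_complex lecR.
  move=> /(_ Hf a); rewrite norm_ReE lecE => /andP[_].
  by case: (k) => ? ? /=; rewrite mulr0 subr0.
have Rek : 0 <= complex.Re k.
  have c1' : continuous (fun _ : A => 1 : R) by move=> ?; exact: cvg_cst.
  have := bnd _ 1 c1'; rewrite normr1 mulr1 => /(_ (fun=> lexx _) a0).
  by apply: le_trans; exact: Re_norm_ge0.
exists (complex.Re k) => // f c cf fc a.
pose g a := t * f a - subst_op rho f a.
have cg : continuous g.
  move=> b; apply: cvgB; last exact: subst_op_continuous.
  by apply: cvgM; [exact: cvg_cst|exact: cf].
have [+ _] := Sinv _ (real_complex_continuous cf).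
rewrite (_ : (fun _ => _) = (fun a => (g a)%:C%C)); last first.
  by apply/funext => b; rewrite rmorphB rmorphM /subst_op rmorph_sum.
move=> E; have := bnd g c cg fc a; rewrite E norm_real_complex /=.
exact.
Qed.

(* The set of the t > 0 such that tf - Mf >= 0 implies f >= 0 is bounded below
   by 1, and it would be open downwards at its infimum. *)
Lemma resolvent_positive_reals :
  ~ (forall t : R, 0 < t -> resolvent_set (@subst_op A rho C) (t%:C%C : C)).
Proof.
move=> res.
pose P t := forall f : A -> R, continuous f ->
  (forall a, 0 <= t * f a - subst_op rho f a) -> forall a, 0 <= f a.
pose good := [set t : R | 0 < t /\ P t].
have size_ge b (x : R) : 0 <= x -> x <= x *+ size (rho b).
  by move=> x0; rewrite -mulr_natr; apply: ler_peMr => //; rewrite ler1n size_subst_gt0.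
(* At a minimum a of [h] the non-empty word [rho a] gives h a <= M h a; with t < 1 and h >= 0 this
   contradicts t h - M h = 1. *)
have good_ge1 t : good t -> 1 <= t.
  move=> [t0 Pt]; have [[h [ch hE]] _] := resolvent_real (res _ t0).
  have h0 : forall a, 0 <= h a by apply: Pt => // a; rewrite hE.
  have [a Ha] := compact_min ch.
  have : h a <= subst_op rho h a.
    apply: le_trans (size_ge a _ (h0 a)) _.
    by rewrite -subst_op_cst; exact: subst_op_le.
  move=> Mh; rewrite leNgt; apply/negP => t1.
  have := hE a; have := h0 a; nra.
(* [N] is the largest |rho(b)| plus 1: at a negative minimum a of [f], N f - M f would be at most f
   a < 0. *)
have [N N0 PN] : exists2 N : R, 0 < N & P N.
  have c1 : continuous (subst_op rho (fun _ : A => 1 : R)).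
    by apply: subst_op_continuous; move=> ?; exact: cvg_cst.
  have [b Hb] := compact_max c1.
  exists (subst_op rho (fun=> 1) b + 1).
    by rewrite subst_op_cst ltr_wpDl// ler0n.
  move=> f cf Hf; have [a Ha] := compact_min cf.
  move=> a'; apply: le_trans (Ha a'); rewrite leNgt; apply/negP => fa0.
  have := Hf a; have := Hb a.
  have : f a * subst_op rho (fun=> 1) a <= subst_op rho f a.
    rewrite -subst_opZ; apply: subst_op_le => b'; rewrite mulr1; exact: Ha.
  set u := subst_op rho (fun=> 1) a; set v := subst_op rho (fun=> 1) b.
  move=> h1 h2 h3; have : (v - u) * f a <= 0.
    by apply: mulr_ge0_le0; [rewrite subr_ge0|exact: ltW].
  by lra.
have good_inf : has_inf good.
  by split; [exists N; split|exists 1 => t; exact: good_ge1].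
set ti := inf good.
have ti1 : 1 <= ti by apply: lb_le_inf; [exists N; split|exact: good_ge1].
have [_ [k k0 Hk]] := resolvent_real (res ti (lt_le_trans ltr01 ti1)).
(* [k] bounds the inverse at the infimum [ti]. For t within d / 2 above [ti] the solution [h] is at
   most 2 k', and d = 1 / (4 k') makes d h <= 1/2. The summand 1 in k' gives d <= 1/4, so that t - d
   stays positive. *)
pose k' := k + 1; pose d := (4 * k')^-1.
have k'1 : 1 <= k' by rewrite /k' lerDr.
have dE : d * (4 * k') = 1 by rewrite mulVf// gt_eqF//; lra.
have d0 : 0 < d by rewrite invr_gt0; lra.
have [t [t0 Pt] tlt] := inf_adherent (divr_gt0 d0 (ltr0n R 2)) good_inf.
have tile : ti <= t by apply: inf_lbound => //; case: good_inf.
have [[h [ch hE]] _] := resolvent_real (res _ t0).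
have [a Ha] := compact_max (f := fun a => `|h a|) (fun a => cvg_norm (ch a)).
set m := `|h a| in Ha; have m0 : 0 <= m by exact: normr_ge0.
have m2 : m <= 2 * k'.
  have : m <= k * (1 + d / 2 * m).
    apply: Hk => // b.
    rewrite (_ : _ - _ = 1 + (ti - t) * h b); last by rewrite -(hE b); ring.
    rewrite (le_trans (ler_normD _ _))// normr1 lerD2l normrM ler_pM//.
    by rewrite ler0_norm; lra.
  have d2m : 0 <= 1 + d / 2 * m by rewrite addr_ge0// mulr_ge0//; lra.
  have := ler_wpM2r d2m (_ : k <= k'); rewrite /k' lerDl => /(_ ler01) h1 h2.
  have : k' * (d / 2 * m) = m / 8.
    by transitivity (d * (4 * k') * (m / 8)); [field|rewrite dE mul1r].
  by rewrite /k' in h1 h2 *; lra.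
have good' : good (t - d).
  have d1 : d <= 4^-1 by rewrite lef_pV2 ?posrE; lra.
  split; first by lra.
  move=> f cf Hf; have [b Hb] := compact_min cf.
  move=> b'; apply: le_trans (Hb b'); rewrite leNgt; apply/negP => fb0.
  (* Adding d n h to [f], whose minimum is -n, makes positivity at [t] applicable; but the
     correction is at most n / 2 at the minimum, too small to compensate -n. *)
  pose n := - f b; have n0 : 0 < n by rewrite oppr_gt0.
  have cg : continuous (fun a => f a + d * n * h a).
    move=> a'; apply: cvgD; first exact: cf.
    by apply: cvgM; [exact: cvg_cst|exact: ch].
  have gb : 0 <= f b + d * n * h b.
    apply: (Pt _ cg) => a'; rewrite subst_opD subst_opZ.
    rewrite (_ : _ - _ = ((t - d) * f a' - subst_op rho f a') + d * (f a' + n)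
       + d * n * ((t * h a' - subst_op rho h a') - 1)); last by ring.
    rewrite hE subrr mulr0 addr0 addr_ge0// mulr_ge0//; first exact: ltW.
    by have := Hb a'; rewrite /n; lra.
  have dh : d * h b <= 1 / 2.
    have hb : h b <= 2 * k' by apply: le_trans m2; apply: le_trans (Ha b); exact: ler_norm.
    by have := ler_wpM2l (ltW d0) hb; lra.
  by have := ler_wpM2l (ltW n0) dh; rewrite /n in gb n0 *; lra.
have : ti <= t - d by apply: inf_lbound => //; case: good_inf.
by rewrite -/ti in tlt *; lra.
Qed.


End NonnegativeOperator.

(** * The Neumann series outside the growth rate *)

Lemma continuous_approx (K : numFieldType) (T : topologicalType) (F : T -> K) :
  (forall e, 0 < e -> exists2 g : T -> K, continuous g & forall t, `|F t - g t| <= e) ->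
  continuous F.
Proof.
move=> H t; apply/cvgrPdist_lt => e e0.
have e4 : 0 < e / 4 by rewrite divr_gt0.
have [g cg Fg] := H _ e4; move/cvgrPdist_lt: (cg t) => /(_ _ e4).
apply: filterS => u gtu.
rewrite (_ : F t - F u = (F t - g t) + (g t - g u) - (F u - g u)); last by ring.
apply: (@le_lt_trans _ _ (e / 4 + e / 4 + e / 4)).
  apply: le_trans (ler_normB _ _) _; apply: lerD => //.
  by apply: le_trans (ler_normD _ _) _; apply: lerD => //; exact: ltW.
rewrite [ltRHS](_ : e = e / 4 + e / 4 + e / 4 + e / 4); last by field.
by rewrite ltrDl.
Qed.

Section NeumannSeries.
Variables (K : numFieldType) (A : topologicalType) (rho : substitution A) (z : K).
Hypothesis z0 : z != 0.
Local Notation M := (@subst_op A rho K).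
Implicit Type f : A -> K.

Definition neumann_term f i a : K := iter i M f a / z ^+ i.

Definition neumann_sum f n a : K := z^-1 * \sum_(i < n) neumann_term f i a.

Lemma neumann_sum_continuous f n : continuous f -> continuous (neumann_sum f n).
Proof.
move=> cf a; apply: cvgM; first exact: cvg_cst.
apply: cvg_bigsum => i; apply: cvgM; last exact: cvg_cst.
move: a; elim: (i : nat) => //= j IH; exact: subst_op_continuous.
Qed.

Let telescope_term f n a :
  \sum_(i < n) (neumann_term f i a - neumann_term f i.+1 a) =
  f a - neumann_term f n a.
Proof.
rewrite -(big_mkord xpredT (fun i => neumann_term f i a - neumann_term f i.+1 a)).
rewrite -[LHS]opprK -sumrN (eq_bigr (fun i =>
  neumann_term f i.+1 a - neumann_term f i a)) => [|i _]; last by rewrite opprB.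
by rewrite telescope_sumr// opprB /neumann_term/= expr0 divr1.
Qed.

(** Telescoping leaves only the first and the last term; [neumann_suml] treats the other order,
    since a resolvent is a two-sided inverse. *)
Lemma neumann_sumr f n a :
  z * neumann_sum f n a - subst_op rho (neumann_sum f n) a =
  f a - neumann_term f n a.
Proof.
rewrite -telescope_term sumrB /neumann_sum subst_opZ mulrA divff// mul1r.
congr (_ - _); rewrite /subst_op exchange_big/= mulr_sumr; apply: eq_bigr => i _.
by rewrite /neumann_term -mulr_suml exprS invfM mulrCA.
Qed.

Lemma neumann_suml f n a :
  neumann_sum (fun a => z * f a - subst_op rho f a) n a = f a - neumann_term f n a.
Proof.
rewrite -telescope_term /neumann_sum mulr_sumr; apply: eq_bigr => i _.
rewrite /neumann_term; set g := fun a => z * f a - _.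
have -> : iter i M g a = z * iter i M f a - iter i.+1 M f a.
  by rewrite iterSr !iter_subst_op /g sumrB mulr_sumr.
by rewrite exprS invfM mulrBl mulrBr !mulrA mulVf// mul1r [z^-1 * _]mulrC.
Qed.

End NeumannSeries.

Section SpectrumBound.
Variables (R : realType) (A : topologicalType) (rho : substitution A).
Hypotheses (cA : compact [set: A]) (a0 : A).
Local Notation C := (R[i] : numFieldType).
Local Notation subst_iter k a := (iter k (subst_word rho) [:: a]).

(** As |M^k f| <= D th^k sup |f|, the Neumann series converges with ratio th / |z|, uniformly in the
    letter. *)
Lemma resolvent_outside (D th : R) (z : C) : 0 < th ->
  (forall k a, (size (subst_iter k a))%:R <= D * th ^+ k) ->
  (th%:C%C : C) < `|z| -> resolvent_set (@subst_op A rho C) z.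
Proof.
move=> th0 growth; set N := complex.Re `|z|.
have NE : `|z| = N%:C%C by exact: norm_ReE.
rewrite NE ltcR => thN; have N0 : 0 < N by exact: lt_trans thN.
have z0 : z != 0 by rewrite -normr_gt0 NE ltcR.
pose q := th / N; have q01 : 0 <= q < 1.
  by rewrite divr_ge0 ?ltW//= ltr_pdivrMr// mul1r.
have [q0 q1] := andP q01.
pose v := neumann_term rho z; pose u := neumann_sum rho z.
have vbound (f : A -> C) (c : R) n a : (forall a, `|f a| <= c%:C%C) ->
    `|v f n a| <= (D * c * q ^+ n)%:C%C.
  move=> fc; rewrite /v /neumann_term normrM normfV normrX NE iter_subst_op.
  have c0 : 0 <= c.
    by have := le_trans (normr_ge0 _) (fc a); rewrite lecR.
  have : `|\sum_(b <- subst_iter n a) f b| <= (D * th ^+ n * c)%:C%C.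
    apply: le_trans (ler_norm_sum _ _ _) _.
    apply: (@le_trans _ _ (\sum_(b <- subst_iter n a) c%:C%C)).
      by apply: ler_sum => b _.
    rewrite big_const_seq count_predT iter_addr_0 -rmorphMn lecR -mulr_natl.
    exact: ler_wpM2r.
  rewrite -rmorphXn -fmorphV => H.
  apply: le_trans (ler_wpM2r _ H) _; first by rewrite lecR invr_ge0 exprn_ge0 ?ltW.
  rewrite -rmorphM lecR /q expr_div_n le_eqVlt; apply/orP; left; apply/eqP.
  by ring.
have D0 : 0 <= D.
  by have := growth 0%N a0; rewrite expr0 mulr1; apply: le_trans.
pose E := 2 * (N^-1 * D / (1 - q)).
have uconv (f : A -> C) (c : R) a : (forall a, `|f a| <= c%:C%C) -> exists l,
    forall n, `|l - u f n a| <= (E * c * q ^+ n)%:C%C.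
  move=> fc.
  have [|l Hl] := @complex_geometric_cauchy R (fun n => u f n a)
    (N^-1 * (D * c)) q q01.
  - move=> n; rewrite /u /neumann_sum -mulrBr big_ord_recr/= addrAC subrr add0r normrM.
    rewrite normfV NE -fmorphV -mulrA rmorphM ler_wpM2l//; last exact: vbound.
    by rewrite lecR invr_ge0 ltW.
  exists l => n; apply: le_trans (Hl n) _; rewrite lecR le_eqVlt.
  by apply/orP; left; apply/eqP; rewrite /E; ring.
have qcvg (x : nat -> C) l (B : R) : (forall n, `|l - x n| <= (B * q ^+ n)%:C%C) ->
    x @ \oo --> l.
  move=> Hx; apply/cvgrPdist_lt => e e_gt0.
  have /complex_realP[d dE] : e \is Num.real by exact: gtr0_real.
  rewrite dE ltcR in e_gt0 *.
  have qB : (fun n => B * q ^+ n) @ \oo --> B * 0.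
    by apply: cvgM; [exact: cvg_cst|apply: cvg_expr; rewrite ger0_norm].
  rewrite mulr0 in qB; move/cvgrPdist_lt: qB => /(_ d e_gt0).
  apply: filterS => n; rewrite sub0r normrN => h; apply: le_lt_trans (Hx n) _.
  by rewrite ltcR (le_lt_trans (ler_norm _)).
have hC : hausdorff_space C by exact: norm_hausdorff.
(* The limit is taken pointwise. The uniform error bound in [SP] gives continuity and, for n = 0,
   where the partial sum is empty, boundedness. *)
pose S (f : A -> C) a : C := xget 0 [set l | (fun n => u f n a) @ \oo --> l].
have SP (f : A -> C) (c : R) a : (forall a, `|f a| <= c%:C%C) ->
    (fun n => u f n a) @ \oo --> S f a /\
    forall n, `|S f a - u f n a| <= (E * c * q ^+ n)%:C%C.
  move=> fc; have [l Hl] := uconv f c a fc; have ul := qcvg _ _ _ Hl.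
  have Sl : (fun n => u f n a) @ \oo --> S f a.
    exact: (@xgetPex _ 0 [set l | (fun n => u f n a) @ \oo --> l] (ex_intro _ l ul)).
  by split=> //; rewrite (cvg_unique hC Sl ul).
have bounded (f : A -> C) : continuous f -> exists c : R, forall a, `|f a| <= c%:C%C.
  move=> cf; have [b Hb] := compact_max cA a0 (f := fun a => complex.Re `|f a|)
    (@Re_continuous R A (fun a => `|f a| : C) (fun a => cvg_norm (cf a))).
  by exists (complex.Re `|f b|) => a; rewrite norm_ReE lecR.
have cg (f : A -> C) : continuous f -> continuous (fun a => z * f a - subst_op rho f a).
  move=> cf a; apply: cvgB; last exact: subst_op_continuous.
  by apply: cvgM; [exact: cvg_cst|exact: cf].
have vcvg (f : A -> C) (c : R) a : (forall a, `|f a| <= c%:C%C) ->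
    (fun n => f a - v f n a) @ \oo --> f a.
  move=> fc; rewrite -[X in _ --> X]subr0; apply: cvgB; first exact: cvg_cst.
  by apply: (qcvg _ _ (D * c)) => n; rewrite sub0r normrN; exact: vbound.
exists S; first split.
- move=> f cf; have [c fc] := bounded f cf.
  apply: continuous_approx => e e_gt0.
  have /complex_realP[d dE] : e \is Num.real by exact: gtr0_real.
  rewrite dE ltcR in e_gt0 *.
  have qB : (fun n => E * c * q ^+ n) @ \oo --> E * c * 0.
    by apply: cvgM; [exact: cvg_cst|apply: cvg_expr; rewrite ger0_norm].
  rewrite mulr0 in qB; move/cvgrPdist_lt: qB => /(_ d e_gt0)[n _ /(_ n (leqnn n))].
  rewrite sub0r normrN => h; exists (u f n); first exact: neumann_sum_continuous.
  move=> a; have [_ /(_ n)/le_trans] := SP _ _ a fc; apply.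
  by rewrite lecR (le_trans (ler_norm _))// ltW.
- move=> x f g cf cg'; apply/funext => a.
  have [c fc] := bounded f cf; have [d gd] := bounded g cg'.
  have [e he] := bounded (fun a => x * f a + g a) (fun a =>
    cvgD (cvgM (cvg_cst x) (cf a)) (cg' a)).
  have [h1 _] := SP _ _ a fc; have [h2 _] := SP _ _ a gd; have [h3 _] := SP _ _ a he.
  apply: (cvg_unique hC h3).
  have uE n : u (fun a => x * f a + g a) n a = x * u f n a + u g n a.
    rewrite /u /neumann_sum mulrCA -mulrDr; congr (_ * _).
    rewrite mulr_sumr -big_split/=; apply: eq_bigr => i _.
    rewrite /neumann_term !iter_subst_op big_split/= -mulr_sumr.
    by rewrite mulrDl mulrA.
  rewrite (_ : (fun n => u _ n a) = (fun n => x * u f n a + u g n a)).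
    exact: (cvgD (cvgM (cvg_cst x) h1) h2).
  by apply/funext => n; exact: uE.
- exists (E%:C%C : C) => f c cf fc a.
  have /complex_realP[d dE] : c \is Num.real.
    by apply: ger0_real; apply: le_trans (fc a).
  rewrite dE in fc *; have [_ /(_ 0%N)] := SP _ _ a fc.
  by rewrite /u /neumann_sum big_ord0 mulr0 subr0 expr0 mulr1 rmorphM.
move=> f cf; have [c fc] := bounded f cf; split; apply/funext => a.
  have [d gd] := bounded _ (cg f cf); have [h _] := SP _ _ a gd.
  apply: (cvg_unique hC h).
  rewrite (_ : (fun n => u _ n a) = (fun n => f a - v f n a)).
    exact: vcvg fc.
  by apply/funext => n; exact: neumann_suml.
have : (fun n => z * u f n a - subst_op rho (u f n) a) @ \oo -->
    z * S f a - subst_op rho (S f) a.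
  apply: cvgB.
    by apply: cvgM; [exact: cvg_cst|exact: (SP _ _ a fc).1].
  by apply: cvg_bigsum => b; exact: (SP _ _ b fc).1.
rewrite (_ : (fun n => z * u f n a - _) = (fun n => f a - v f n a)).
  by move=> h; exact: (cvg_unique hC h (vcvg f c a fc)).
by apply/funext => n; exact: neumann_sumr.
Qed.

End SpectrumBound.

(** * Growth of the iterates against the spectral radius *)

Section SpectralRadius.
Variables (R : realType) (A : topologicalType) (rho : substitution A).
Hypotheses (cA : compact [set: A]) (a0 : A).
Local Notation C := (R[i] : numFieldType).
Local Notation subst_iter k a := (iter k (subst_word rho) [:: a]).
Local Notation r := (spectral_radius R rho).

Let spectral_moduli := [set x : R | exists2 z : C,
  @spectrum A C (@subst_op A rho C) z & `|z| = x%:C%C].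

Let moduli_ub (D th : R) : 0 < th ->
  (forall k a, (size (subst_iter k a))%:R <= D * th ^+ k) ->
  ubound spectral_moduli th.
Proof.
move=> th0 growth x [z spz zx]; rewrite leNgt; apply/negP => thx.
by apply: spz; apply: (resolvent_outside cA a0 th0 growth); rewrite zx ltcR.
Qed.

Lemma spectral_radius_le (D th : R) : 0 < th ->
  (forall k a, (size (subst_iter k a))%:R <= D * th ^+ k) -> r <= th.
Proof.
move=> th0 growth; have ub := moduli_ub th0 growth.
rewrite (_ : r = sup spectral_moduli)//.
(* The supremum of the empty set is 0 by convention. *)
have [->|ne] := eqVneq spectral_moduli set0; first by rewrite sup0 ltW.
by apply: ge_sup => //; exact/set0P.
Qed.

Lemma size_iter_substD (x y : R) m n : 0 <= x ->
  (forall a, (size (subst_iter m a))%:R <= x) ->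
  (forall a, (size (subst_iter n a))%:R <= y) ->
  forall a, (size (subst_iter (m + n) a))%:R <= x * y.
Proof.
move=> x0 Hx Hy a; rewrite iter_substD size_flatten /shape -map_comp sumnE.
rewrite big_map natr_sum; apply: (@le_trans _ _ (\sum_(b <- subst_iter n a) x)).
  by apply: ler_sum => b _; exact: Hx.
by rewrite big_const_seq count_predT iter_addr_0 -mulr_natr ler_wpM2l.
Qed.

Lemma size_iter_subst_exp (x : R) m q : 0 <= x ->
  (forall a, (size (subst_iter m a))%:R <= x) ->
  forall a, (size (subst_iter (q * m) a))%:R <= x ^+ q.
Proof.
move=> x0 Hx; elim: q => [|q IH] a; first by rewrite expr0.
by rewrite mulSn exprS; apply: size_iter_substD.
Qed.

Lemma size_subst_bound : exists2 L : R, 1 <= L & forall a, (size (rho a))%:R <= L.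
Proof.
have c1 : continuous (subst_op rho (fun _ : A => 1 : R)).
  by apply: subst_op_continuous; move=> ?; exact: cvg_cst.
have [b Hb] := compact_max cA a0 c1.
exists (size (rho b))%:R; first by rewrite ler1n size_subst_gt0.
by move=> a; have := Hb a; rewrite !subst_op_cst.
Qed.

Let size_iter_bound (L : R) k : 0 <= L -> (forall a, (size (rho a))%:R <= L) ->
  forall a, (size (subst_iter k a))%:R <= L ^+ k.
Proof.
move=> L0 HL b; rewrite -[in leLHS](muln1 k); apply: size_iter_subst_exp => // a.
by rewrite /= /subst_word /= cats0.
Qed.

Lemma spectral_radius_gt0 : 0 < r.
Proof.
have [L L1 HL] := size_subst_bound; have L0 : 0 < L by exact: lt_le_trans L1.
have ub : ubound spectral_moduli L.
  apply: (@moduli_ub 1) => // k a; rewrite mul1r.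
  by apply: size_iter_bound => //; exact: ltW.
have [t t0 spt] : exists2 t : R, 0 < t & spectrum (@subst_op A rho C) t%:C%C.
  apply: contrapT => H; apply: (@resolvent_positive_reals R A rho cA a0) => t t0.
  by apply: contrapT => nres; apply: H; exists t.
have tmod : spectral_moduli t.
  by exists t%:C%C => //; rewrite norm_real_complex gtr0_norm.
by apply: lt_le_trans t0 _; apply: sup_upper_bound => //; split; [exists t|exists L].
Qed.

Let bernoulli (x : R) n : 0 <= x <= 1 -> 1 - n%:R * x <= (1 - x) ^+ n.
Proof.
move=> /andP[x0 x1]; elim: n => [|n IH]; first by rewrite mul0r subr0 expr0.
have x10 : 0 <= 1 - x by rewrite subr_ge0.
rewrite exprS; apply: le_trans (ler_wpM2l x10 IH).
have n0 : 0 <= n%:R :> R by [].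
by rewrite -natr1; have := mulr_ge0 n0 (mulr_ge0 x0 x0); lra.
Qed.

(* Otherwise Bernoulli's inequality gives the growth rate r (1 - 1 / 2n) < r. *)
Lemma spectral_radius_growth n :
  ~ (forall a, (size (subst_iter n a))%:R <= r ^+ n / 2).
Proof.
move=> Hn; have r0 := spectral_radius_gt0.
case: n Hn => [|n Hn]; first by move=> /(_ a0); rewrite expr0 /=; lra.
have [L L1 HL] := size_subst_bound; have L0 : 0 < L by exact: lt_le_trans L1.
pose x : R := (2 * n.+1%:R)^-1.
have n1 : 1 <= n.+1%:R :> R by rewrite ler1n.
have xE : x * (2 * n.+1%:R) = 1 by rewrite mulVf// gt_eqF//; lra.
have x0 : 0 < x by rewrite invr_gt0; lra.
have x2 : x <= 2^-1 by rewrite lef_pV2 ?posrE; lra.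
pose th := r * (1 - x); have th0 : 0 < th by rewrite mulr_gt0//; lra.
suff : r <= th by rewrite /th; nra.
have th_ge0 := ltW th0; have r_ge0 := ltW r0.
have thn : r ^+ n.+1 / 2 <= th ^+ n.+1.
  rewrite exprMn; apply: ler_wpM2l; first exact: exprn_ge0.
  apply: le_trans (bernoulli _ _); last by lra.
  by lra.
(* In the division of k by n + 1, each full block contributes th^(n+1); since L <= B th, the fewer
   than n + 1 remaining steps go into the constant B^(n+1). *)
pose B := Num.max 1 (L / th); have B1 : 1 <= B by rewrite le_max lexx.
have B_ge0 : 0 <= B by exact: le_trans B1.
have LB : L <= B * th by rewrite -ler_pdivrMr// le_max lexx orbT.
apply: (@spectral_radius_le (B ^+ n.+1)) => // k a.
rewrite [in leLHS](divn_eq k n.+1).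
apply: le_trans (size_iter_substD _ _ _ a) _.
- exact: (exprn_ge0 (k %/ n.+1) (exprn_ge0 n.+1 th_ge0)).
- move=> b; apply: size_iter_subst_exp; first exact: exprn_ge0.
  by move=> b'; exact: le_trans (Hn b') thn.
- by move=> b; apply: size_iter_bound HL b; exact: ltW.
rewrite [in leRHS](divn_eq k n.+1) exprD [in leRHS]mulnC exprM [leRHS]mulrCA.
apply: ler_wpM2l; first by rewrite !exprn_ge0.
apply: (@le_trans _ _ ((B * th) ^+ (k %% n.+1))).
  by apply: lerXn2r => //; rewrite nnegrE; [exact: ltW|exact: mulr_ge0].
rewrite exprMn; apply: ler_wpM2r; first exact: exprn_ge0.
by rewrite ler_weXn2l// ltnW// ltn_mod.
Qed.

End SpectralRadius.

(** * Natural length functions *)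

Section NaturalLengths.
Variables (R : realType) (A : topologicalType) (rho : substitution A).
Hypotheses (cA : compact [set: A]) (irr : irreducible rho).
Hypothesis expanding : exists a, (1 < size (rho a))%N.
Local Notation M := (@subst_op A rho R).
Local Notation subst_iter k a := (iter k (subst_word rho) [:: a]).
Local Notation r := (spectral_radius R rho).
Implicit Types f g l : A -> R.

Let a0 : A := projT1 (cid expanding).

Let invariant_full (C : set A) : closed C -> C !=set0 ->
  (forall c, C c -> forall b, b \in rho c -> C b) -> forall a, C a.
Proof.
move=> cC C0 inv a; have [->//|CT] := eqVneq C setT.
by exfalso; apply: irr; exists C; split.
Qed.

Lemma sum_eq0_nonneg l u : (forall a, 0 <= l a) -> \sum_(b <- u) l b = 0 ->
  forall b, b \in u -> l b = 0.
Proof.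
move=> l0 /eqP; rewrite psumr_eq0// => /allP H b bu.
by apply/eqP; exact: (H b bu).
Qed.

Lemma eigen_zero l (lambda : R) : continuous l -> (forall a, 0 <= l a) ->
  (forall a, subst_op rho l a = lambda * l a) -> (exists a, l a = 0) ->
  forall a, l a = 0.
Proof.
move=> cl l0 Ml [c lc]; apply: (@invariant_full [set a | l a = 0]) => //.
- apply: (@closed_comp _ _ l [set x : R | x = 0]) => [a _|]; first exact: cl.
  exact: closed_eq.
- by exists c.
- move=> a /= la b bu; apply: (sum_eq0_nonneg l0 _ bu).
  by rewrite -[LHS]/(subst_op rho l a) Ml la mulr0.
Qed.

Lemma natural_length_gt0 l lambda : natural_length rho l lambda ->
  forall a, 0 < l a.
Proof.
move=> [cl l0 [b lb] _ Ml] a; rewrite lt_def l0 andbT; apply/eqP => la.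
by move/eqP: lb; apply; apply: (eigen_zero cl l0 Ml); exists a.
Qed.

(* The largest ratio [g / l] is attained at a zero of [c l - g >= 0]. *)
Let ratio l g : continuous l -> continuous g -> (forall a, 0 < l a) ->
  exists c a, (forall b, g b <= c * l b) /\ g a = c * l a.
Proof.
move=> cl cg l0.
have [a Ha] := compact_max cA a0 (f := fun a => g a / l a) (fun a =>
  cvgM (cg a) (cvgV (lt0r_neq0 (l0 a)) (cl a))).
exists (g a / l a), a; split; last by rewrite divfK// gt_eqF.
by move=> b; rewrite -ler_pdivrMr.
Qed.

Lemma eigenfunction_proportional l g lambda : continuous l -> continuous g ->
  (forall a, 0 < l a) -> (forall a, subst_op rho l a = lambda * l a) ->
  (forall a, subst_op rho g a = lambda * g a) -> exists c, forall a, g a = c * l a.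
Proof.
move=> cl cg l0 Ml Mg; have [c [a [gc ga]]] := ratio cl cg l0.
exists c => b; apply/esym/eqP; rewrite -subr_eq0; apply/eqP; move: b.
apply: (@eigen_zero (fun b => c * l b - g b) lambda).
- move=> b; apply: cvgB; last exact: cg.
  by apply: cvgM; [exact: cvg_cst|exact: cl].
- by move=> b; rewrite subr_ge0.
- move=> b; rewrite /subst_op sumrB -mulr_sumr -[X in c * X]/(subst_op rho l b).
  by rewrite -[X in _ - X]/(subst_op rho g b) Ml Mg; ring.
- by exists a; rewrite ga subrr.
Qed.

(** At a letter a where l' <= c l is an equality, applying M yields lambda' l' a <= c lambda l a =
    lambda l' a. Used in both directions, this forces every natural length function to have
    inflation factor r. *)
Lemma eigenvalue_le l l' lambda lambda' : continuous l -> continuous l' ->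
  (forall a, 0 < l a) -> (forall a, 0 < l' a) ->
  (forall a, subst_op rho l a = lambda * l a) ->
  (forall a, subst_op rho l' a = lambda' * l' a) -> lambda' <= lambda.
Proof.
move=> cl cl' l0 l'0 Ml Ml'; have [c [a [Hc ca]]] := ratio cl cl' l0.
have : subst_op rho l' a <= lambda * l' a.
  rewrite [in leRHS]ca mulrCA -Ml -subst_opZ; exact: subst_op_le.
by rewrite Ml' ler_pM2r.
Qed.

Hypothesis conv : strongly_power_convergent (fun f a => subst_op rho f a / r).

Let r0 : 0 < r. Proof. exact: spectral_radius_gt0. Qed.

Let iter_scaled f n a :
  iter n (fun f a => subst_op rho f a / r) f a = iter n M f a / r ^+ n.
Proof.
elim: n a => [|n IH] a /=; first by rewrite expr0 divr1.
rewrite exprS invfM mulrCA mulrC; congr (_ * _).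
by rewrite /subst_op mulr_suml; apply: eq_bigr => b _; exact: IH.
Qed.

Lemma power_limit f : continuous f -> exists2 g, continuous g &
  forall e, 0 < e -> exists N, forall n, (N <= n)%N -> forall a,
    `|iter n M f a / r ^+ n - g a| <= e.
Proof.
move=> cf; have [g cg Hg] := conv cf; exists g => // e e0.
have : nbhs (g : {uniform A -> R}) [set h | forall a, `|h a - g a| <= e].
  apply/uniform_nbhs; exists [set xy | ball xy.1 e xy.2]; split.
    exact: (entourage_ball R (PosNum e0)).
  by move=> h Hh a; have /= := Hh a I; rewrite -ball_normE/= distrC => /ltW.
move=> /Hg[N _ HN]; exists N => n Nn a; have /= := HN n Nn a.
by rewrite iter_scaled.
Qed.

Lemma power_limit_fixed f g : (forall e, 0 < e -> exists N, forall n,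
    (N <= n)%N -> forall a, `|iter n M f a / r ^+ n - g a| <= e) ->
  forall a, subst_op rho g a = r * g a.
Proof.
move=> H; have cv a : (fun n => iter n M f a / r ^+ n) @ \oo --> g a.
  apply/cvgrPdist_le => e e0; have [N HN] := H e e0.
  by exists N => // n Nn /=; rewrite distrC; exact: HN.
move=> a; have h : (fun n => r * (iter n.+1 M f a / r ^+ n.+1)) @ \oo --> r * g a.
  apply: cvgM; first exact: cvg_cst.
  by have := cv a; rewrite -(cvg_shiftS (fun n => iter n M f a / r ^+ n)).
apply: (cvg_unique _ _ h); first exact: norm_hausdorff.
rewrite (_ : (fun n => _ * _) = (fun n => \sum_(b <- rho a) iter n M f b / r ^+ n)).
  by apply: cvg_bigsum => b; exact: cv.
apply/funext => n; rewrite exprS invfM mulrCA mulVKf ?gt_eqF//.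
by rewrite -mulr_suml.
Qed.

Lemma natural_length_exists : exists l, natural_length rho l r.
Proof.
have c1 : continuous (fun _ : A => 1 : R) by move=> ?; exact: cvg_cst.
have [l cl Hl] := power_limit c1.
have size_iter n a : iter n M (fun=> 1) a = (size (subst_iter n a))%:R.
  by rewrite iter_subst_op big_const_seq count_predT iter_addr_0.
exists l; split=> //; last exact: power_limit_fixed Hl.
- move=> a; apply/ler_addgt0Pr => e e0; have [N /(_ _ (leqnn N) a)] := Hl e e0.
  have : 0 <= iter N M (fun=> 1) a / r ^+ N.
    by rewrite size_iter divr_ge0// exprn_ge0// ltW.
  by rewrite ler_distl => h /andP[_]; lra.
(* A zero limit would give some N with |rho^N| <= r^N / 2 at all letters, which
   [spectral_radius_growth] excludes. *)
- apply: contrapT => nl; have l0 a : l a = 0.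
    by apply/eqP/negPn/negP => la; apply: nl; exists a.
  have half : 0 < 2^-1 :> R by rewrite invr_gt0.
  have [N /(_ N (leqnn N)) HN] := Hl _ half.
  apply: (@spectral_radius_growth R A rho cA a0 N) => a.
  have := HN a; rewrite l0 subr0 size_iter => h.
  have rN : 0 < r ^+ N by exact: exprn_gt0.
  by rewrite mulrC -ler_pdivrMr// (le_trans (ler_norm _)).
- exact: ltW.
Qed.

Lemma spectral_radius_gt1 l : natural_length rho l r -> 1 < r.
Proof.
move=> nl; have l0 := natural_length_gt0 nl; case: nl => cl _ _ _ Ml.
have [a Ha] := compact_min cA a0 cl.
have size_le b : l a * (size (rho b))%:R <= subst_op rho l b.
  by rewrite mulr_natr -subst_op_cst; exact: subst_op_le.
have r1 : 1 <= r.
  have := size_le a; rewrite Ml mulrC ler_pM2r// => /(le_trans _); apply.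
  by rewrite ler1n size_subst_gt0.
rewrite lt_def r1 andbT; apply/eqP => rE.
(* If r = 1, then at a letter c where [l] is minimal the sum of [l] over [rho c] is only l c, so all
   letters of [rho c] are minimal too. Irreducibility makes [l] constant, and a letter b with
   |rho(b)| >= 2 refutes r = 1. *)
have : forall b, l b = l a.
  apply: (@invariant_full [set b | l b = l a]); last 1 first.
  - move=> c /= lc b bc; apply/esym/eqP; rewrite -subr_eq0 -oppr_eq0 opprB.
    apply/eqP; apply: (@sum_eq0_nonneg (fun b => l b - l a) (rho c)) => //.
      by move=> b'; rewrite subr_ge0.
    apply/eqP; rewrite eq_le; apply/andP; split; last first.
      by apply: sumr_ge0 => b' _; rewrite subr_ge0.
    rewrite sumrB -[X in X - _]/(subst_op rho l c) Ml rE mul1r lc.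
    rewrite subr_le0 big_const_seq count_predT iter_addr_0 -mulr_natr.
    by rewrite ler_peMr ?(ltW (l0 a))// ler1n size_subst_gt0.
  - apply: (@closed_comp _ _ l [set x : R | x = l a]) => [b _|]; first exact: cl.
    exact: closed_eq.
  - by exists a.
move=> lE; have [b b1] := expanding; have := size_le b.
rewrite Ml rE mul1r lE -{2}(mulr1 (l a)) ler_pM2l// -[X in _ <= X -> _]/(1%:R).
by rewrite ler_nat leqNgt b1.
Qed.

Lemma natural_length_unique l l' lambda' : natural_length rho l r ->
  natural_length rho l' lambda' -> exists c, forall a, l' a = c * l a.
Proof.
move=> nl nl'; have l0 := natural_length_gt0 nl; have l'0 := natural_length_gt0 nl'.
case: nl nl' => [cl _ _ _ Ml] [cl' _ _ _ Ml'].
apply: (eigenfunction_proportional cl cl' l0 Ml).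
suff -> : r = lambda' by [].
by apply/eqP; rewrite eq_le !(eigenvalue_le _ _ _ _ Ml Ml', eigenvalue_le _ _ _ _ Ml' Ml).
Qed.

Lemma power_asymptotics l f : natural_length rho l r -> continuous f ->
  exists phi, forall e, 0 < e -> exists n0, forall n, (n0 <= n)%N -> forall a,
    `|iter n M f a - phi * r ^+ n * l a| <= e * r ^+ n.
Proof.
move=> nl cf; have l0 := natural_length_gt0 nl; case: nl => cl _ _ _ Ml.
have [g cg Hg] := power_limit cf.
have [phi gE] := eigenfunction_proportional cl cg l0 Ml (power_limit_fixed Hg).
exists phi => e e0; have [n0 Hn] := Hg e e0; exists n0 => n nn a.
have rn : 0 < r ^+ n by exact: exprn_gt0.
apply: le_trans (ler_wpM2r (ltW rn) (Hn n nn a)).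
rewrite -[X in _ <= _ * X](gtr0_norm rn) -normrM le_eqVlt; apply/orP; left; apply/eqP.
by congr `|_|; rewrite gE mulrBl divfK ?gt_eqF//; ring.
Qed.

End NaturalLengths.

(** * Uniform frequencies *)

Section FullShift.
Variable A : topologicalType.
Hypotheses (cA : compact [set: A]) (hA : hausdorff_space A).
Local Notation seqZ := {ptws int -> A}.

Lemma near_neq (S T : topologicalType) (f g : S -> T) (p : S) :
  hausdorff_space T -> {for p, continuous f} -> {for p, continuous g} ->
  f p <> g p -> \forall q \near p, f q <> g q.
Proof.
move=> hT cf cg /eqP fg; move: hT; rewrite open_hausdorff => /(_ _ _ fg).
move=> [[U V] /= [Uf Vg] [oU oV UV0]].
have Uq : \forall q \near p, U (f q).
  by apply: cf; apply: open_nbhs_nbhs; split=> //; exact: set_mem.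
have Vq : \forall q \near p, V (g q).
  by apply: cg; apply: open_nbhs_nbhs; split=> //; exact: set_mem.
near=> q => fgq; suff : (U `&` V) (f q) by rewrite (eqP UV0).
by split; [near: q|rewrite fgq; near: q].
Unshelve. all: by end_near. Qed.

Lemma full_shift_compact : compact [set: seqZ].
Proof.
have := @tychonoff int (fun=> A) (fun=> setT) (fun=> cA).
by rewrite (_ : [set f | _] = setT)//; apply/seteqP; split.
Qed.

Lemma full_shift_hausdorff : hausdorff_space seqZ.
Proof. exact: (@hausdorff_product int (fun=> A) (fun=> hA)). Qed.

Definition agree (m : nat) (x y : seqZ) : Prop :=
  forall i : int, (`|i| <= m)%N -> x i = y i.

(** Compactness of the square of the full shift: near the diagonal continuity of [G] suffices, and
    near a pair that differs at i no pair agrees on a window of radius at least |i|. *)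
Lemma uniformly_local (R : realType) (G : seqZ -> R) : continuous G ->
  forall e, 0 < e -> exists m, forall x y, agree m x y -> `|G x - G y| <= e.
Proof.
move=> cG e e0.
pose P m (q : seqZ * seqZ) := agree m q.1 q.2 -> `|G q.1 - G q.2| <= e.
have cXX : compact [set: seqZ * seqZ].
  by rewrite -setXTT; apply: compact_setX; exact: full_shift_compact.
have [|N _ HN] := (compact_near_coveringP _).1 cXX nat \oo P _.
  move=> [x y] _; have [<-|/eqP xy] := eqVneq x y.
    have cGG : {for (x, x), continuous (fun q : seqZ * seqZ => G q.1 - G q.2)}.
      apply: cvgB.
        by apply: (@continuous_comp _ _ _ fst G); [exact: cvg_fst|exact: cG].
      by apply: (@continuous_comp _ _ _ snd G); [exact: cvg_snd|exact: cG].
    move/cvgrPdist_le: cGG => /(_ e e0) /= H.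
    exists ([set q | `|G q.1 - G q.2| <= e], setT) => /=.
      split; last exact: filterT.
      by apply: filterS H => q; rewrite subrr sub0r normrN.
    by move=> [q m] [/= h _] _.
  have [i xyi] : exists i, x i <> y i.
    by apply/existsNP => xy'; apply: xy; exact/funext.
  exists ([set q : seqZ * seqZ | q.1 i <> q.2 i], [set m | (`|i| <= m)%N]) => /=.
    split; last by exists `|i|%N.
    apply: (@near_neq _ _ (fun q : seqZ * seqZ => q.1 i) (fun q => q.2 i)) => //.
      by apply: (@continuous_comp _ _ _ fst (fun x : seqZ => x i));
        [exact: cvg_fst|exact: ptws_continuous].
    by apply: (@continuous_comp _ _ _ snd (fun x : seqZ => x i));
      [exact: cvg_snd|exact: ptws_continuous].
  by move=> [q m] [/= qi im]; rewrite /P => /(_ i im).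
by exists N => x y; exact: (HN N (leqnn N) (x, y) I).
Qed.

Definition shift_by (j : int) (x : seqZ) : seqZ := fun i => x (i + j).

Lemma shift_by_continuous j : continuous (shift_by j).
Proof. by apply: continuous_ptws => i; exact: (@ptws_continuous _ int (i + j)). Qed.

Lemma shift_byD i j x : shift_by i (shift_by j x) = shift_by (i + j) x.
Proof. by apply/funext => k; rewrite /shift_by addrA. Qed.

Definition fill (c : A) (u : word A) : seqZ :=
  fun i => if i is Posz n then nth c u n else c.

Lemma fill_continuous c : continuous (fill c).
Proof.
apply: continuous_ptws => -[n|n]; first exact: nth_word_continuous.
exact: cst_continuous.
Qed.

Lemma size_factor (x : int -> A) p n : size (factor x p n) = n.
Proof. exact: size_mkseq. Qed.

Lemma nth_factor c (x : int -> A) p n i : (i < n)%N ->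
  nth c (factor x p n) i = x (p + i%:Z).
Proof. exact: nth_mkseq. Qed.

Lemma factorD (x : int -> A) p m n :
  factor x p (m + n) = factor x p m ++ factor x (p + m%:Z) n.
Proof.
rewrite /factor /mkseq iotaD map_cat; congr (_ ++ _).
rewrite add0n -[X in iota X _]addn0 iotaDl -map_comp; apply: eq_map => i /=.
by rewrite PoszD addrA.
Qed.

Lemma factor_fill c u : factor (fill c u) 0 (size u) = u.
Proof.
apply: (@eq_from_nth _ c); rewrite size_factor// => i iu.
by rewrite nth_factor// add0r.
Qed.

Lemma factor_continuous p n : continuous (fun x : seqZ => factor x p n : word A).
Proof.
have [[c _]|noA] := pselect (exists c : A, True); last first.
  by move=> x; case: noA; exists (x 0).
move=> x; apply: (@cvg_word A c seqZ (fun x => factor x p n) x).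
  by near=> y; rewrite !size_factor.
move=> i; have [lt_in|le_ni] := ltnP i n.
  rewrite (_ : (fun x => _) = (fun x : seqZ => x (p + i%:Z))).
    exact: ptws_continuous.
  by apply/funext => y; rewrite nth_factor.
rewrite (_ : (fun x => _) = (fun=> c)); first exact: cst_continuous.
by apply/funext => y; rewrite nth_default// size_factor.
Unshelve. all: by end_near. Qed.

End FullShift.

(** * Window sums and their approximate additivity *)

Section WindowSums.
Variables (R : realType) (A : topologicalType) (G : {ptws int -> A} -> R) (c : A).
Local Notation seqZ := {ptws int -> A}.

Definition orbit_sum (x : seqZ) (p : int) (n : nat) : R :=
  \sum_(i < n) G (shift_by (p + i%:Z) x).

Definition word_sum (u : word A) : R := orbit_sum (fill c u) 0 (size u).

Lemma word_sum_continuous : continuous G -> continuous word_sum.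
Proof.
move=> cG; apply: (@sum_word_continuous A R
  (fun i u => G (shift_by (0 + i%:Z) (fill c u)))) => i u.
apply: (@continuous_comp (word A) seqZ R (fun u => shift_by (0 + i%:Z) (fill c u)) G).
  apply: (@continuous_comp (word A) seqZ seqZ (fill c) (shift_by (0 + i%:Z))).
    exact: fill_continuous.
  exact: shift_by_continuous.
exact: cG.
Qed.

Lemma orbit_sumD x p m n :
  orbit_sum x p (m + n) = orbit_sum x p m + orbit_sum x (p + m%:Z) n.
Proof.
rewrite /orbit_sum big_split_ord/=; congr (_ + _).
by apply: eq_bigr => i _; rewrite PoszD addrA.
Qed.

Variables (B e : R) (m : nat).
Hypotheses (GB : forall x, `|G x| <= B)
  (Gm : forall x y, agree m x y -> `|G x - G y| <= e).

Let B0 : 0 <= B. Proof. exact: le_trans (GB (fun=> c)). Qed.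
Let e0 : 0 <= e. Proof. by apply: le_trans (Gm (x := fun=> c) (y := fun=> c) _). Qed.

Local Notation D := (4 * m%:R * B).

Lemma orbit_sum_le x p n : `|orbit_sum x p n| <= n%:R * B.
Proof.
apply: le_trans (ler_norm_sum _ _ _) _; rewrite -[n in leRHS]card_ord.
by rewrite mulr_natl -sumr_const; apply: ler_sum => i _.
Qed.

Let sum_lt n : (\sum_(i < n) (i < m) <= m)%N.
Proof.
suff -> : (\sum_(i < n) (i < m) = minn n m)%N by exact: geq_minr.
elim: n => [|n IH]; first by rewrite big_ord0 min0n.
by rewrite big_ord_recr/= IH; lia.
Qed.

(* Positions further than [m] from both ends of [u] see the same window in [x]
   and in [fill c u]. *)
Lemma orbit_sum_factor x p u : factor x p (size u) = u ->
  `|orbit_sum x p (size u) - word_sum u| <= e * (size u)%:R + D.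
Proof.
set n := size u => xu; rewrite /word_sum /orbit_sum -sumrB.
apply: le_trans (ler_norm_sum _ _ _) _.
(* Besides the [e] paid at every position, each of the at most 2 m positions near an end costs 2 B,
   in total D = 4 m B. *)
have term (i : 'I_n) : `|G (shift_by (p + i%:Z) x) -
    G (shift_by (0 + i%:Z) (fill c u))| <=
    e + 2 * B * ((i < m)%N%:R + (rev_ord i < m)%N%:R).
  have [mi|im] := ltnP i m.
    apply: le_trans (ler_normB _ _) _; have := GB (shift_by (p + i%:Z) x).
    have := GB (shift_by (0 + i%:Z) (fill c u)).
    have : 0 <= B * (rev_ord i < m)%N%:R by exact: mulr_ge0.
    by rewrite [true%:R]mulr1n; move: e0 B0 => *; lra.
  have [mi'|im'] := ltnP (rev_ord i) m.
    apply: le_trans (ler_normB _ _) _; have := GB (shift_by (p + i%:Z) x).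
    have := GB (shift_by (0 + i%:Z) (fill c u)).
    by rewrite [true%:R]mulr1n [false%:R]mulr0n; move: e0 B0 => *; lra.
  rewrite [false%:R]mulr0n addr0 mulr0 addr0; apply: Gm => k km.
  have [j kj jn] : exists2 j : nat, k + i%:Z = j%:Z & (j < n)%N.
    by exists `|(k + i%:Z)%R|%N; move: km im im' (ltn_ord i) => /=; lia.
  rewrite /shift_by add0r kj /fill -{1}xu nth_factor//.
  by rewrite -kj; congr x; ring.
apply: le_trans (ler_sum _ (fun i _ => term i)) _.
rewrite big_split/= sumr_const card_ord; apply: lerD; first by rewrite mulr_natr.
rewrite -mulr_sumr big_split/=.
have h1 : \sum_(i < n) (i < m)%N%:R <= m%:R :> R by rewrite -natr_sum ler_nat.
have h2 : \sum_(i < n) (rev_ord i < m)%N%:R <= m%:R :> R.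
  rewrite (reindex_inj rev_ord_inj)/=.
  by under eq_bigr => i _ do rewrite -[X in (X < m)%N]/(val (rev_ord (rev_ord i))) rev_ordK.
have := ler_wpM2l B0 (lerD h1 h2); lra.
Qed.

(** The error is [e] per letter and [D] per block, so it is small relative to the length once the
    blocks are long. *)
Lemma orbit_sum_flatten x p (us : seq (word A)) :
  factor x p (size (flatten us)) = flatten us ->
  `|orbit_sum x p (size (flatten us)) - \sum_(u <- us) word_sum u| <=
  e * (size (flatten us))%:R + D * (size us)%:R.
Proof.
elim: us p => [|u us IH] p.
  by rewrite /orbit_sum /= big_ord0 big_nil subrr normr0 !mulr0 addr0.
rewrite /= size_cat factorD => /eqP; rewrite eqseq_cat ?size_factor//.
move=> /andP[/eqP h1 /eqP h2]; rewrite orbit_sumD big_cons opprD addrACA.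
apply: le_trans (ler_normD _ _) _.
have := orbit_sum_factor h1; have := IH _ h2.
by rewrite natrD -natr1; lra.
Qed.

Lemma word_sum_flatten (us : seq (word A)) :
  `|word_sum (flatten us) - \sum_(u <- us) word_sum u| <=
  e * (size (flatten us))%:R + D * (size us)%:R.
Proof. by apply: orbit_sum_flatten; exact: factor_fill. Qed.

End WindowSums.

(** * Cutting subwords of a concatenation into blocks *)

Lemma flatten_suffix (T : Type) (L : nat) (us : seq (seq T)) p t :
  all (fun u => size u <= L)%N us -> flatten us = p ++ t ->
  exists s k, [/\ t = s ++ flatten (drop k us) & (size s <= L)%N].
Proof.
elim: us p => [|u us IH] p /=.
  by move=> _; case: p => //= <-; exists [::], 0%N.
move=> /andP[uL usL] E; have [pu|up] := leqP (size p) (size u).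
  exists (drop (size p) u), 1%N; split; last by rewrite size_drop; lia.
  have := congr1 (drop (size p)) E; rewrite [RHS]drop_size_cat// => <-.
  rewrite drop_cat /= drop0; case: ltnP => // up.
  have e : size p = size u by lia.
  by rewrite e subnn drop0 drop_size.
have [s [k [tE sL]]] : exists s k, [/\ t = s ++ flatten (drop k us) & (size s <= L)%N].
  apply: (IH (drop (size u) p)) => //.
  have := congr1 (drop (size u)) E; rewrite drop_size_cat// => ->.
  by rewrite drop_cat up.
by exists s, k.+1.
Qed.

Lemma flatten_prefix (T : Type) (L : nat) (us : seq (seq T)) u t :
  all (fun u => size u <= L)%N us -> flatten us = u ++ t ->
  exists k s, [/\ u = flatten (take k us) ++ s & (size s <= L)%N].
Proof.
elim: us u => [|v us IH] u /=.
  by move=> _; case: u => // _; exists 0%N, [::].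
move=> /andP[vL usL] E; have [uv|vu] := ltnP (size u) (size v).
  exists 0%N, u; split=> //; lia.
have E' := congr1 (drop (size v)) E; rewrite drop_size_cat// drop_cat in E'.
have uE : u = v ++ drop (size v) u.
  have := congr1 (take (size v)) E; rewrite take_size_cat// take_cat.
  case: ltnP => vu'; first by move=> {1}->; rewrite cat_take_drop.
  have e : size v = size u by lia.
  by rewrite e subnn take0 cats0 drop_size cats0.
have [k [s [sE sL]]] : exists k s,
    [/\ drop (size v) u = flatten (take k us) ++ s & (size s <= L)%N].
  apply: IH => //; rewrite E'; case: ltnP => // uv.
  have e : size v = size u by lia.
  by rewrite e subnn drop0 drop_size.
by exists k.+1, s; rewrite /= -catA -sE.
Qed.

Lemma infix_flatten (T : eqType) (L : nat) (us : seq (seq T)) u :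
  all (fun u => size u <= L)%N us -> infix u (flatten us) ->
  exists s1 us' s2, [/\ u = s1 ++ flatten us' ++ s2, {subset us' <= us},
    (size s1 <= L)%N & (size s2 <= L)%N].
Proof.
move=> usL /infixP[p [t E]]; have [s1 [k [E1 s1L]]] := flatten_suffix usL E.
(* A subword that ends inside the block in which it starts is its own left remnant. *)
have [us1|s1u] := leqP (size u) (size s1).
  exists u, [::], [::]; split; [by rewrite /= cats0|by []| |by []].
  exact: leq_trans us1 s1L.
have usL' : all (fun u => size u <= L)%N (drop k us).
  by apply/allP => v /mem_drop; exact: (allP usL).
have E2 : flatten (drop k us) = drop (size s1) u ++ t.
  by have := congr1 (drop (size s1)) E1; rewrite [RHS]drop_size_cat// drop_cat s1u.
have [k' [s2 [E3 s2L]]] := flatten_prefix usL' E2.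
exists s1, (take k' (drop k us)), s2; split=> //; last first.
  by move=> v /mem_take /mem_drop.
rewrite -E3 -[LHS](cat_take_drop (size s1)); congr (_ ++ _).
by have := congr1 (take (size s1)) E1; rewrite [RHS]take_size_cat// take_cat s1u.
Qed.

Lemma le_sum_seq (R : numDomainType) (T : Type) (f : T -> R) x (u : seq T) :
  (forall b, x <= f b) -> x * (size u)%:R <= \sum_(b <- u) f b.
Proof.
move=> xf; rewrite mulr_natr -iter_addr_0 -(count_predT u) -big_const_seq.
by apply: ler_sum => b _.
Qed.

Lemma ge_sum_seq (R : numDomainType) (T : Type) (f : T -> R) x (u : seq T) :
  (forall b, f b <= x) -> \sum_(b <- u) f b <= x * (size u)%:R.
Proof.
move=> xf; rewrite mulr_natr -iter_addr_0 -(count_predT u) -big_const_seq.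
by apply: ler_sum => b _.
Qed.

Lemma nat_above (R : realType) (x : R) :
  exists n0, forall n, (n0 <= n)%N -> x <= n%:R.
Proof.
exists (Num.bound `|x|) => n nn; apply: le_trans (ler_norm x) _.
by apply: le_trans (ltW (archi_boundP (normr_ge0 x))) _; rewrite ler_nat.
Qed.

Lemma exp_above (R : realType) (x y : R) : 1 < y -> exists n, x <= y ^+ n.
Proof.
move=> y1; have y10 : 0 < y - 1 by rewrite subr_gt0.
have [n Hn] := nat_above (x / (y - 1)); exists n.
have := Hn n (leqnn n); rewrite ler_pdivrMr// => /le_trans; apply.
suff : 1 + n%:R * (y - 1) <= y ^+ n by lra.
elim: {Hn} n => [|n IH]; first by rewrite mul0r addr0 expr0.
have y0 : 0 <= y by lra.
rewrite exprS; apply: le_trans (ler_wpM2l y0 IH).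
have n0 : 0 <= n%:R :> R by [].
by have := mulr_ge0 n0 (mulr_ge0 (ltW y10) (ltW y10)); rewrite -natr1; lra.
Qed.

Section UniformFrequencies.
Variables (R : realType) (A : topologicalType) (rho : substitution A).
Hypotheses (cA : compact [set: A]) (hA : hausdorff_space A).
Hypothesis irr : irreducible rho.
Hypothesis expanding : exists a, (1 < size (rho a))%N.
Local Notation r := (spectral_radius R rho).
Hypothesis conv : strongly_power_convergent (fun (f : A -> R) a => subst_op rho f a / r).
Variable l : A -> R.
Hypothesis nl : natural_length rho l r.
Local Notation M := (@subst_op A rho R).
Local Notation subst_iter k a := (iter k (subst_word rho) [:: a]).

Let c0 : A := projT1 (cid expanding).
Let l_gt0 : forall a, 0 < l a. Proof. exact: natural_length_gt0 nl. Qed.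
Let r_gt1 : 1 < r. Proof. exact: spectral_radius_gt1 nl. Qed.
Let r_gt0 : 0 < r. Proof. exact: lt_trans r_gt1. Qed.
Let l_cont : continuous l. Proof. by case: nl. Qed.

Lemma length_bounds : exists lm lM : R, [/\ 0 < lm, lm <= lM &
  forall a, lm <= l a <= lM].
Proof.
have [a Ha] := compact_min cA c0 l_cont; have [b Hb] := compact_max cA c0 l_cont.
by exists (l a), (l b); split=> // c; rewrite Ha Hb.
Qed.

Lemma length_subst_iter k a : \sum_(b <- subst_iter k a) l b = r ^+ k * l a.
Proof.
rewrite -iter_subst_op; case: nl => _ _ _ _ Ml; elim: k a => [|k IH] a /=.
  by rewrite expr0 mul1r.
rewrite /subst_op (eq_bigr (fun b => r ^+ k * l b)); last by move=> b _; exact: IH.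
by rewrite -mulr_sumr -[X in _ * X]/(subst_op rho l a) Ml exprSr mulrA.
Qed.

(** The length of rho^k(a) is exactly r^k l(a), and [l] lies between positive constants, so counting
    letters instead costs at most the factor lM / lm. *)
Lemma size_subst_iter_bounds : exists2 C : R, 0 < C & forall k a,
  (size (subst_iter k a))%:R <= C * r ^+ k /\
  r ^+ k <= C * (size (subst_iter k a))%:R.
Proof.
have [lm [lM [lm0 lmM Hl]]] := length_bounds.
have lM0 : 0 < lM by exact: lt_le_trans lmM.
exists (lM / lm); first by rewrite divr_gt0.
move=> k a; have := length_subst_iter k a; set u := subst_iter k a => E.
have lo : lm * (size u)%:R <= r ^+ k * l a.
  by rewrite -E; apply: le_sum_seq => b; case/andP: (Hl b).
have hi : r ^+ k * l a <= lM * (size u)%:R.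
  by rewrite -E; apply: ge_sum_seq => b; case/andP: (Hl b).
have rk : 0 <= r ^+ k by rewrite exprn_ge0// ltW.
have /andP[la laM] := Hl a.
have h1 := ler_wpM2l rk la; have h2 := ler_wpM2l rk laM.
rewrite ![lM / lm * _]mulrAC ler_pdivlMr// ler_pdivlMr//.
by split; [rewrite mulrC [lM * _]mulrC|rewrite mulrC];
  [exact: le_trans (le_trans lo h2) _|rewrite mulrC; exact: le_trans h1 hi].
Qed.

Variable G : {ptws int -> A} -> R.
Hypothesis G_cont : continuous G.
Local Notation W := (word_sum G c0).

Let G_bound : exists2 B, 0 <= B & forall x, `|G x| <= B.
Proof. exact: (compact_norm_bound (full_shift_compact cA) (fun=> c0) G_cont). Qed.

(* If W_n(a) is the window sum of rho^n(a), then W_(n+k) differs from M^k W_n by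
   a boundary term, which is small against r^(n+k) for n large. *)
Let level_estimate B eta : (forall x, `|G x| <= B) -> 0 < eta -> exists m j c,
  [/\ forall x y, agree m x y -> `|G x - G y| <= eta,
      forall a, `|W (subst_iter j a) - c * (r ^+ j * l a)| <= eta * r ^+ j &
      4 * m%:R * B <= eta * r ^+ j].
Proof.
move=> GB eta0; have B0 : 0 <= B by exact: le_trans (GB (fun=> c0)).
have [C C0 HC] := size_subst_iter_bounds.
(* [eta] is split in three: window variation over at most C r^(n+k) letters, boundary [D] on at most
   C r^k blocks, and the convergence of M^k W_n. The order of choice is [e], then [m] and [D], then
   [n] with [D] small against r^n, then [k]. *)
pose e := eta / (3 * (C + 1)); have C3 : 0 < 3 * (C + 1) by lra.
have e0 : 0 < e by rewrite divr_gt0.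
have eE : e * (3 * (C + 1)) = eta by rewrite divfK// gt_eqF.
have eC0 : 0 < e * C by exact: mulr_gt0.
have [m Gm] := uniformly_local cA hA G_cont e0.
pose D := 4 * m%:R * B; have D0 : 0 <= D by rewrite !mulr_ge0.
have [n Hn] := exp_above (D * (3 * (C + 1)) / eta) r_gt1.
rewrite ler_pdivrMr// in Hn.
have rn : 0 < r ^+ n by exact: exprn_gt0.
pose Wn a := W (subst_iter n a).
have Wn_cont : continuous Wn.
  move=> a; apply: (@continuous_comp A (word A) R (fun a => subst_iter n a) W).
    exact: iter_subst_continuous.
  exact: word_sum_continuous.
have [phi Hphi] := power_asymptotics cA irr expanding conv nl Wn_cont.
have e2 : 0 < eta / 3 * r ^+ n by rewrite mulr_gt0// divr_gt0.
have [k Hk] := Hphi _ e2; exists m, (n + k)%N, (phi / r ^+ n).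
have rk : 0 < r ^+ k by exact: exprn_gt0.
have rk1 : 1 <= r ^+ k by rewrite exprn_ege1// ltW.
split.
- move=> x y /Gm /le_trans; apply; rewrite -eE; lra.
- move=> a; have h1 := Hk k (leqnn k) a; rewrite iter_subst_op in h1.
  have h2 := word_sum_flatten c0 GB Gm [seq subst_iter n b | b <- subst_iter k a].
  rewrite -iter_substD big_map size_map -/D in h2.
  have [h3 _] := HC (n + k)%N a; have [h4 _] := HC k a.
  have h5 := ler_wpM2l (ltW e0) h3; have h6 := ler_wpM2l D0 h4.
  have -> : phi / r ^+ n * (r ^+ (n + k) * l a) = phi * r ^+ k * l a.
    by rewrite exprD; field; rewrite gt_eqF.
  move: h1 h2; set X := \sum_(_ <- _) _; set Y := phi * _ * _; set Z := W _.
  move=> h1 h2; have -> : Z - Y = (Z - X) + (X - Y) by lra.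
  apply: le_trans (ler_normD _ _) _.
  apply: (@le_trans _ _ (e * (C * r ^+ (n + k)) + D * (C * r ^+ k)
      + eta / 3 * r ^+ n * r ^+ k)); first by lra.
  rewrite !exprD; have h7 : D * C * r ^+ k <= eta / 3 * r ^+ n * r ^+ k.
    apply: ler_wpM2r; first exact: ltW.
    by have := mulr_ge0 D0 (ltW C0); lra.
  have h8 : e * C * (r ^+ n * r ^+ k) <= eta / 3 * (r ^+ n * r ^+ k).
    by apply: ler_wpM2r; [rewrite mulr_ge0// ltW|lra].
  by lra.
- rewrite -/D exprD mulrA; apply: (@le_trans _ _ (eta * r ^+ n)).
    by have := mulr_ge0 D0 (ltW C0); lra.
  by rewrite ler_peMr// mulr_ge0// ltW.
Qed.

Let generated_frequency B eta : (forall x, `|G x| <= B) -> 0 < eta ->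
  exists m c n0, (forall x y, agree m x y -> `|G x - G y| <= eta) /\
    forall u, generated rho u -> (n0 <= size u)%N ->
      `|W u - c * \sum_(a <- u) l a| <= eta * (size u)%:R.
Proof.
move=> GB eta0; have B0 : 0 <= B by exact: le_trans (GB (fun=> c0)).
have [C C0 HC] := size_subst_iter_bounds.
have [lm [lM [lm0 lmM Hl]]] := length_bounds.
(* The factor 2 + 2 C counts the errors per letter of [u]: [eta'] for the windows, C [eta'] for
   block boundaries, C [eta'] for the blocks themselves, and [eta'] for the bounded terms collected
   in [K]. *)
pose eta' := eta / (2 + 2 * C); have C2 : 0 < 2 + 2 * C by lra.
have eta'0 : 0 < eta' by rewrite divr_gt0.
have etaE : eta' * (2 + 2 * C) = eta by rewrite divfK// gt_eqF.
have [m [j [c [Gm Hj HD]]]] := level_estimate GB eta'0.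
have rj : 0 < r ^+ j by exact: exprn_gt0.
have [L HL] := nat_above (C * r ^+ j).
pose K : R := 2 * eta' * r ^+ j + 2 * B * L%:R + 2 * `|c| * lM * L%:R.
have [n1 Hn1] := nat_above (K / eta').
exists m, c, (maxn L.+1 n1); split.
  move=> x y /Gm /le_trans; apply; rewrite -etaE.
  by have := mulr_gt0 eta'0 C0; lra.
move=> u [a [N uN]]; rewrite geq_max => /andP[Lu n1u].
(* Iterates below j have at most C r^j <= L letters, too few to contain [u]. *)
have jN : (j <= N)%N.
  rewrite leqNgt; apply/negP => Nj; move: Lu; rewrite ltnNge => /negP; apply.
  apply: leq_trans (size_infix uN) _; rewrite -(ler_nat R).
  apply: le_trans (HC N a).1 _; apply: le_trans (HL L (leqnn L)).
  by rewrite ler_pM2l//; apply: ler_weXn2l; [exact: ltW|exact: ltnW].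
rewrite -(subnK jN) addnC iter_substD in uN.
have [|s1 [us [s2 [uE usub s1L s2L]]]] := infix_flatten (L := L) _ uN.
  apply/allP => _ /mapP[b _ ->]; rewrite -(ler_nat R).
  exact: le_trans (HC j b).1 (HL L (leqnn L)).
have usE v : v \in us -> exists b, v = subst_iter j b.
  by move=> /usub /mapP[b _ ->]; exists b.
pose d v := W v - c * \sum_(a <- v) l a.
have h1 := word_sum_flatten c0 GB Gm (s1 :: rcons us s2).
have fE : flatten (s1 :: rcons us s2) = u.
  by rewrite uE /= -cats1 flatten_cat /= cats0.
rewrite fE in h1.
have dsmall s : (size s <= L)%N -> `|d s| <= B * L%:R + `|c| * lM * L%:R.
  move=> sL; have sLR : (size s)%:R <= L%:R :> R by rewrite ler_nat.
  have lM0 : 0 <= lM by lra.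
  apply: le_trans (ler_normB _ _) _; apply: lerD.
    apply: le_trans (orbit_sum_le GB _ _ _) _.
    by rewrite mulrC; apply: ler_wpM2l.
  rewrite normrM -mulrA; apply: ler_wpM2l => //.
  rewrite ger0_norm; last by apply: sumr_ge0 => b _; exact: ltW.
  apply: (@le_trans _ _ (lM * (size s)%:R)); last exact: ler_wpM2l.
  by apply: ge_sum_seq => b; case/andP: (Hl b).
have dmid : `|\sum_(v <- us) d v| <= eta' * C * (size u)%:R /\
    r ^+ j * (size us)%:R <= C * (size u)%:R.
  have sus : r ^+ j * (size us)%:R <= C * (size u)%:R.
    apply: (@le_trans _ _ (C * (size (flatten us))%:R)).
      rewrite size_flatten sumnE big_map natr_sum mulr_sumr mulr_natr.
      rewrite -iter_addr_0 -(count_predT us) -big_const_seq.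
      rewrite !big_seq; apply: ler_sum => v /usE[b ->]; exact: (HC j b).2.
    by rewrite ler_pM2l// ler_nat uE !size_cat addnCA leq_addr.
  split=> //; apply: le_trans (ler_norm_sum _ _ _) _.
  apply: (@le_trans _ _ (eta' * r ^+ j * (size us)%:R)); last first.
    by rewrite -[leLHS]mulrA -[leRHS]mulrA; apply: ler_wpM2l; [exact: ltW|exact: sus].
  rewrite mulr_natr -iter_addr_0 -(count_predT us) -big_const_seq.
  rewrite !big_seq; apply: ler_sum => v /usE[b ->].
  by rewrite /d length_subst_iter; exact: Hj.
have h2 : W u - c * \sum_(a <- u) l a = (W u - \sum_(v <- s1 :: rcons us s2) W v)
    + (d s1 + \sum_(v <- us) d v + d s2).
  have -> : \sum_(a <- u) l a = \sum_(a <- s1) l a +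
      \sum_(v <- us) \sum_(a <- v) l a + \sum_(a <- s2) l a.
    by rewrite uE !big_cat big_flatten /= addrA.
  rewrite /d sumrB -mulr_sumr big_cons -cats1 big_cat big_seq1 /=.
  by ring.
rewrite h2; apply: le_trans (ler_normD _ _) _.
have h3 := dsmall _ s1L; have h4 := dsmall _ s2L; have [h5 h6] := dmid.
have h7 := Hn1 _ n1u; rewrite ler_pdivrMr// in h7.
have KE : K = 2 * eta' * r ^+ j + 2 * B * L%:R + 2 * `|c| * lM * L%:R by [].
have h8 : `|d s1 + \sum_(v <- us) d v + d s2| <=
    `|d s1| + `|\sum_(v <- us) d v| + `|d s2|.
  apply: le_trans (ler_normD _ _) _; rewrite lerD2r; exact: ler_normD.
have h9 : 4 * m%:R * B * (size (s1 :: rcons us s2))%:R <=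
    eta' * r ^+ j * (2 + (size us)%:R).
  have -> : (size (s1 :: rcons us s2))%:R = 2 + (size us)%:R :> R.
    by rewrite /= size_rcons -[(size us).+2]add2n natrD.
  by apply: ler_wpM2r => //; rewrite addr_ge0.
have h10 := ler_wpM2l (ltW eta'0) h6.
have h11 : eta' * (2 + 2 * C) * (size u)%:R = eta * (size u)%:R by rewrite etaE.
by clearbody eta' K d; lra.
Qed.

Lemma uniform_frequencies e : 0 < e -> exists c N, forall n, (N <= n)%N ->
  forall x, subshift rho x ->
  `|orbit_sum G x 0 n - c * \sum_(i < n) l (x i%:Z)| <= e * n%:R.
Proof.
move=> e0; have [B B0 GB] := G_bound.
have e3 : 0 < e / 3 by rewrite divr_gt0.
have [m [c [n0 [Gm Hgen]]]] := generated_frequency GB e3.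
have [n1 Hn1] := nat_above (4 * m%:R * B / (e / 3)).
exists c, (maxn n0 n1) => n; rewrite geq_max => /andP[n0n n1n] x Xx.
pose h (u : word A) := W u - c * \sum_(a <- u) l a.
have ch : continuous h.
  move=> u; have cl := @sum_letters_continuous A R l l_cont u.
  exact: (cvgB (@word_sum_continuous R A G c0 G_cont u) (cvgM (cvg_cst c) cl)).
set u : word A := factor x 0 n; have su : size u = n by exact: size_factor.
(* A factor of [x] is only a limit of generated words; the estimate survives because [h] is
   continuous and words near [u] have the size of [u]. *)
have hu : `|h u| <= e / 3 * n%:R.
  rewrite leNgt; apply/negP => hu.
  have H : \forall v \near u, e / 3 * n%:R < `|h v|.
    have cnh : continuous (fun v => `|h v|) by move=> v; exact: (cvg_norm (ch v)).
    have := cnh u [set y | e / 3 * n%:R < y]; apply.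
    by apply: open_nbhs_nbhs; split=> //; exact: open_gt.
  have [v [genv [szv]]] := Xx 0 n _ (filterI (size_near u) H).
  by rewrite ltNge -su -szv Hgen// szv su.
have h1 := @orbit_sum_factor _ _ G c0 B (e / 3) m GB Gm x 0 u.
rewrite su -/u in h1; have {}h1 := h1 erefl.
have h2 := Hn1 n n1n; rewrite ler_pdivrMr// in h2.
have lE : \sum_(i < n) l (x i%:Z) = \sum_(a <- u) l a.
  rewrite -(big_mkord xpredT (fun i => l (x i%:Z))) /index_iota subn0.
  by rewrite /u /Defs.factor /mkseq big_map; apply: eq_bigr => i _; rewrite add0r.
rewrite lE; rewrite /h in hu.
rewrite (_ : _ - _ = (orbit_sum G x 0 n - W u) + (W u - c * \sum_(a <- u) l a)).
  by apply: le_trans (ler_normD _ _) _; lra.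
by ring.
Qed.

End UniformFrequencies.

(** * The geometric hull *)

Section SubshiftTopology.
Variables (A : topologicalType) (rho : substitution A).
Hypotheses (cA : compact [set: A]) (hA : hausdorff_space A).
Local Notation seqZ := {ptws int -> A}.
Local Notation subst_iter k a := (iter k (subst_word rho) [:: a]).

Lemma subshift_closed : closed (subshift rho : set seqZ).
Proof.
rewrite (_ : subshift rho = \bigcap_i \bigcap_n
    [set x : seqZ | language rho (factor x i n)]); last first.
  apply/seteqP; split=> x Xx; first by move=> i _ n _; exact: Xx.
  by move=> i n; exact: Xx.
apply: closed_bigI => i _; apply: closed_bigI => n _.
apply: (@closed_comp seqZ (word A) (fun x => factor x i n)).
  by move=> x _; exact: factor_continuous.
exact: closed_closure.
Qed.

Lemma set_type_compact (T : topologicalType) (K : set T) :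
  compact K -> compact [set: K].
Proof.
move=> cK F PF _; have PF' : ProperFilter (set_val @ F) by exact: fmap_proper_filter.
have [|x [Kx Fx]] := cK (set_val @ F) PF'.
  by apply: (@filterS _ F _ setT _ _ filterT) => y _; exact: set_valP.
exists (SigSub (mem_set Kx)); split=> // U V FU.
rewrite nbhsE => -[_ [[W oW <-] Wx] WV].
have [_ [[y Uy <-] Wy]] : set_val @` U `&` W !=set0.
  have FU' : F (set_val @^-1` (set_val @` U)) by apply: filterS FU => y Uy; exists y.
  by apply: (Fx _ _ FU'); apply: open_nbhs_nbhs; split.
by exists y; split=> //; exact: WV.
Qed.

Lemma subshift_compact : compact [set: subshift rho].
Proof.
apply: set_type_compact; apply: subclosed_compact (full_shift_compact cA) _ => //.
exact: subshift_closed.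
Qed.

Lemma set_type_hausdorff (T : topologicalType) (K : set T) :
  hausdorff_space T -> hausdorff_space K.
Proof.
move=> hT p q pq; apply: val_inj; apply: hT => U V Up Vq.
have cv : continuous (set_val : K -> T) by exact: initial_continuous.
have [y [Uy Vy]] := pq _ _ (cv p _ Up) (cv q _ Vq).
by exists (set_val y).
Qed.

Lemma infix_factor (c : A) (u : word A) (i n : nat) : (i + n <= size u)%N ->
  infix (factor (fill c u) i%:Z n) u.
Proof.
move=> inu; suff -> : factor (fill c u) i%:Z n = take n (drop i u).
  apply: infix_trans (infix_take _ _) _; exact: infix_drop.
apply: (@eq_from_nth _ c).
  by rewrite size_factor size_take size_drop; case: ltnP => // ?; lia.
by move=> j; rewrite size_factor => jn; rewrite nth_factor// nth_take// nth_drop.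
Qed.

Lemma factor_shift_by (x : seqZ) j i n :
  factor (shift_by j x) i n = factor x (i + j) n.
Proof. by apply: eq_mkseq => k; rewrite /shift_by addrAC. Qed.

(** Long generated words, centred at the origin, have a cluster point in the full shift; each of its
    windows is a limit of genuine subwords. *)
Lemma subshift_nonempty : (forall n, exists k a, (n <= size (subst_iter k a))%N) ->
  subshift rho !=set0.
Proof.
move=> H; have [_ [c _]] := H 0%N.
(* With 2 n + 1 letters, n of them remain on each side of the origin. *)
have [u Hu] : {u : nat -> word A & forall n,
    generated rho (u n) /\ (n + n.+1 <= size (u n))%N}.
  apply: (@choice _ _ (fun n u => generated rho u /\ (n + n.+1 <= size u)%N)) => n.
  have [k [a nk]] := H (n + n.+1)%N; exists (subst_iter k a); split=> //.
  by exists a, k; exact: infix_refl.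
pose x n : seqZ := shift_by n%:Z (fill c (u n)).
have [|y [_ xy]] := @full_shift_compact A cA (x @ \oo) _ _; first exact: filterT.
exists y => i n.
have cl : closed [set z : seqZ | language rho (factor z i n)].
  apply: (@closed_comp seqZ (word A) (fun x => factor x i n)).
    by move=> z _; exact: factor_continuous.
  exact: closed_closure.
apply: cl => V Vy; apply: xy => //.
exists (`|i| + n)%N => // k /= ink; apply: subset_closure.
have [j jE] : exists j : nat, i + k%:Z = j%:Z by exists `|(i + k%:Z)%R|%N; lia.
have [[a [N uN]] szu] := Hu k; exists a, N; apply: infix_trans uN.
by rewrite factor_shift_by jE; apply: infix_factor; lia.
Qed.

Lemma subshift_shift_by j x : subshift rho x -> subshift rho (shift_by j x).
Proof. by move=> Xx i n; rewrite factor_shift_by; exact: Xx. Qed.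

Definition shift_byX j (x : subshift rho) : subshift rho :=
  SigSub (mem_set (@subshift_shift_by j (set_val x) (set_valP x))).

Lemma shift_byXE j x i : set_val (shift_byX j x) i = set_val x (i + j).
Proof. by []. Qed.

Lemma shift_byX_continuous j : continuous (shift_byX j).
Proof.
apply: (@continuous_comp_initial _ _ _ set_val).
rewrite (_ : set_val \o shift_byX j = shift_by j \o set_val)//.
move=> x; apply: continuous_comp; first exact: initial_continuous.
exact: shift_by_continuous.
Qed.

Lemma shift_byXD i j x : shift_byX i (shift_byX j x) = shift_byX (i + j) x.
Proof. by apply: val_inj; exact: shift_byD. Qed.

Lemma shift_byX0 x : shift_byX 0 x = x.
Proof. by apply: val_inj; apply/funext => i; rewrite /= /shift_by addr0. Qed.

Lemma shiftX_shift_by x : shiftX x = shift_byX 1 x.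
Proof. exact: val_inj. Qed.

End SubshiftTopology.

(** * The hull as the orbit space of a homeomorphism *)

Section HullTopology.
Variables (R : realType) (A : topologicalType) (rho : substitution A).
Hypotheses (cA : compact [set: A]) (hA : hausdorff_space A).
Variable l : A -> R.
Hypothesis l_cont : continuous l.
Variables lm lM : R.
Hypotheses (lm_gt0 : 0 < lm) (l_bounds : forall a, lm <= l a <= lM).
Local Open Scope quotient_scope.

Local Notation X := (subshift rho).
Local Notation Y := (hull_cover R rho).
Local Notation pr := (\pi_(hull rho l) : Y -> hull rho l).

(** The relation generating the hull is the graph of this homeomorphism of the cover, so questions
    on the quotient become questions on its powers. *)
Definition suspension_map (p : Y) : Y :=
  (shift_byX 1 p.1, p.2 - l (set_val p.1 0)).

Definition suspension_inv (p : Y) : Y :=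
  (shift_byX (-1) p.1, p.2 + l (set_val p.1 (-1))).

Local Notation tau := suspension_map.
Local Notation tau' := suspension_inv.

Lemma suspension_mapK : cancel tau tau'.
Proof.
case=> x s; rewrite /tau /tau' /= shift_byXD addNr shift_byX0.
by rewrite shift_byXE addNr subrK.
Qed.

Lemma suspension_invK : cancel tau' tau.
Proof.
case=> x s; rewrite /tau /tau' /= shift_byXD subrr shift_byX0.
by rewrite shift_byXE add0r addrK.
Qed.

Let coord_continuous (i : int) : continuous (fun p : Y => l (set_val p.1 i)).
Proof.
move=> p; apply: (@continuous_comp Y A R (fun p => set_val p.1 i) l); last exact: l_cont.
apply: (@continuous_comp Y {ptws int -> A} A (fun p => set_val p.1) (fun x => x i)).
  apply: (@continuous_comp Y X {ptws int -> A} fst set_val); first exact: cvg_fst.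
  exact: initial_continuous.
exact: ptws_continuous.
Qed.

Let fst_shift_continuous (i : int) : continuous (fun p : Y => shift_byX i p.1).
Proof.
move=> p; apply: (@continuous_comp Y X X fst (shift_byX i)); first exact: cvg_fst.
exact: shift_byX_continuous.
Qed.

Lemma suspension_map_continuous : continuous tau.
Proof.
move=> p; exact: (cvg_pair (@fst_shift_continuous 1 p)
  (cvgB cvg_snd (@coord_continuous 0 p))).
Qed.

Lemma suspension_inv_continuous : continuous tau'.
Proof.
move=> p; exact: (cvg_pair (@fst_shift_continuous (-1) p)
  (cvgD cvg_snd (@coord_continuous (-1) p))).
Qed.

Lemma hull_stepE p q : hull_step l p q <-> q = tau p.
Proof.
split.
  by move=> [x [s [-> ->]]]; rewrite /tau /= shiftX_shift_by addrK.
move=> ->; exists p.1, (p.2 - l (set_val p.1 0)); split.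
  by rewrite subrK; case: p.
by rewrite shiftX_shift_by.
Qed.

Lemma iter_suspension_inj n : injective (iter n tau).
Proof. by elim: n => // n IH p q /= /(can_inj suspension_mapK)/IH. Qed.

(** Related points have a common forward image; by injectivity of [tau], cancelling the shorter
    iterate makes one of them a forward image of the other. *)
Lemma hull_eqP p q : pr p = pr q <-> exists n, q = iter n tau p \/ p = iter n tau q.
Proof.
have E n m u v : iter n tau u = iter m tau v ->
    exists k, v = iter k tau u \/ u = iter k tau v.
  have [nm|mn] := leqP n m.
    rewrite -(subnKC nm) iterD => /iter_suspension_inj ->.
    by exists (m - n)%N; right.
  rewrite -(subnKC (ltnW mn)) iterD => /iter_suspension_inj <-.
  by exists (n - m)%N; left.
split.
  move=> /eqmodP/asboolP H.
  suff [n [m /E //]] : exists n m, iter n tau p = iter m tau q.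
  elim: H => [p1 q1 /hull_stepE ->|p1|p1 q1 _ [n [m H]]|p1 q1 u _ [n [m H]] _ [n' [m' H']]].
  - by exists 1%N, 0%N.
  - by exists 0%N, 0%N.
  - by exists m, n.
  - by exists (n' + n)%N, (m + m')%N; rewrite iterD H -iterD addnC iterD H' -iterD.
have step n p' : pr p' = pr (iter n tau p').
  apply/eqmodP/asboolP; elim: n => [|n IH]; first exact: rst_refl.
  by apply: rst_trans IH _; apply: rst_step; apply/hull_stepE.
by move=> [n [->|->]]; rewrite -step.
Qed.

Lemma iter_suspension n p :
  (iter n tau p).2 = p.2 - \sum_(i < n) l (set_val p.1 i%:Z) /\
  set_val (iter n tau p).1 = shift_by n%:Z (set_val p.1).
Proof.
elim: n => [|n [IH1 IH2]].
  rewrite big_ord0 subr0; split=> //; apply/funext => i.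
  by rewrite /shift_by addr0.
rewrite big_ord_recr opprD addrA -IH1 /= IH2; split.
  by rewrite /shift_by add0r.
by apply/funext => i; rewrite shift_byXE IH2 /shift_by -addrA -PoszD add1n.
Qed.

Let sum_length_ge n (x : X) : n%:R * lm <= \sum_(i < n) l (set_val x i%:Z).
Proof.
rewrite mulr_natl -[n in leLHS]card_ord -sumr_const.
by apply: ler_sum => i _; case/andP: (l_bounds (set_val x i%:Z)).
Qed.

(** A step changes the height by at least [lm]: finitely many backward steps make it non-negative,
    then finitely many forward steps bring it below [lM]. *)
Lemma hull_representative (w : hull rho l) : exists (x : X) (s : R),
  w = pr (x, s) /\ 0 <= s <= lM.
Proof.
have lM0 a : 0 < l a by have /andP[h _] := l_bounds a; exact: lt_le_trans h.
have down n p : p.2 <= n%:R * lm -> 0 <= p.2 -> exists x s,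
    pr p = pr (x, s) /\ 0 <= s <= lM.
  elim: n p => [|n IH] p pn p0.
    exists p.1, p.2; split; first by case: p {pn p0}.
    have /andP[h1 h2] := l_bounds (set_val p.1 0).
    rewrite p0 (le_trans pn)// mul0r.
    by apply: le_trans h2; apply: le_trans h1; exact: ltW.
  have [pl|lp] := leP p.2 (l (set_val p.1 0)).
    exists p.1, p.2; split; first by case: p {pn p0 pl}.
    by rewrite p0 (le_trans pl)//; case/andP: (l_bounds (set_val p.1 0)).
  have [||x [s [H1 H2]]] := IH (tau p).
  - rewrite /=; have /andP[h _] := l_bounds (set_val p.1 0).
    by move: pn; rewrite -natr1; lra.
  - by rewrite /= subr_ge0 ltW.
  exists x, s; split=> //; rewrite -H1; apply/hull_eqP; exists 1%N; by left.
have up n p : - p.2 <= n%:R * lm -> exists q, pr p = pr q /\ 0 <= q.2.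
  elim: n p => [|n IH] p pn; first by exists p; split=> //; lra.
  have [|q [H1 H2]] := IH (tau' p).
    rewrite /=; have /andP[h _] := l_bounds (set_val p.1 (-1)).
    by move: pn; rewrite -natr1; lra.
  exists q; split=> //; rewrite -H1; apply/hull_eqP; exists 1%N; right.
  by rewrite /= suspension_invK.
have [n Hn] := nat_above (- (repr w).2 / lm).
have [|q [Hq q0]] := up n (repr w); first by rewrite -ler_pdivrMr// Hn.
have [n' Hn'] := nat_above (q.2 / lm).
have [||x [s [H1 H2]]] := down n' q => //; first by rewrite -ler_pdivrMr// Hn'.
by exists x, s; split=> //; rewrite -H1 -Hq reprK.
Qed.

Lemma hull_compact : compact [set: hull rho l].
Proof.
have cY : compact ([set: X] `*` `[0, lM]%classic : set Y).
  by apply: compact_setX; [exact: subshift_compact|exact: segment_compact].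
rewrite (_ : [set: hull rho l] = pr @` ([set: X] `*` `[0, lM]%classic)).
  apply: continuous_compact => //; apply: continuous_subspaceT.
  exact: pi_continuous.
apply/seteqP; split=> // w _; have [x [s [-> sl]]] := hull_representative w.
by exists (x, s) => //; split=> //=; rewrite in_itv.
Qed.

Let iter_continuous (f : Y -> Y) n : continuous f -> continuous (iter n f).
Proof.
move=> cf; elim: n => [|n IH] p; first exact: cvg_id.
by apply: (@continuous_comp Y Y Y (iter n f) f); [exact: IH|exact: cf].
Qed.

(** The saturation of [U] is the union of its preimages under the powers of [tau] and of its
    inverse. *)
Lemma hull_pi_open (U : set Y) : open U -> open (pr @` U).
Proof.
move=> oU; rewrite (_ : open _ = open (pr @^-1` (pr @` U)))//.
rewrite (_ : pr @^-1` (pr @` U) =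
    \bigcup_n (iter n tau @^-1` U `|` iter n tau' @^-1` U)); last first.
  apply/seteqP; split=> p.
    move=> [q Uq /hull_eqP[n [pE|qE]]]; exists n => //.
      right; rewrite /= pE; suff -> : iter n tau' (iter n tau q) = q by [].
      by elim: (n) => // k IH; rewrite iterSr /= suspension_mapK.
    by left; rewrite /= -qE.
  move=> [n _ [Up|Up]].
    by exists (iter n tau p) => //; apply/hull_eqP; exists n; right.
  exists (iter n tau' p) => //; apply/hull_eqP; exists n; left.
  by elim: (n) => // k IH; rewrite iterSr /= suspension_invK.
apply: bigcup_open => n _; apply: openU.
  by apply: open_comp => // p _; apply: iter_continuous; exact: suspension_map_continuous.
by apply: open_comp => // p _; apply: iter_continuous; exact: suspension_inv_continuous.
Qed.

Lemma hausdorff_pair (S T : topologicalType) :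
  hausdorff_space S -> hausdorff_space T -> hausdorff_space (S * T)%type.
Proof.
move=> hS hT [x1 y1] [x2 y2] H; congr pair.
  apply: hS => U V Ux Vx.
  have [||[z t] [/= [? _] [? _]]] := H (U `*` setT) (V `*` setT); last by exists z.
    by exists (U, setT) => //; split=> //; exact: filterT.
  by exists (V, setT) => //; split=> //; exact: filterT.
apply: hT => U V Uy Vy.
have [||[z t] [/= [_ ?] [_ ?]]] := H (setT `*` U) (setT `*` V); last by exists t.
  by exists (setT, U) => //; split=> //; exact: filterT.
by exists (setT, V) => //; split=> //; exact: filterT.
Qed.

Let bounded_index n (p q : Y) (b : R) : p = iter n tau q -> `|p.2 - q.2| <= b ->
  n%:R * lm <= b.
Proof.
move=> pE; have [E _] := iter_suspension n q; rewrite pE E => h.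
apply: le_trans (sum_length_ge n q.1) _; apply: le_trans h.
by rewrite addrAC subrr add0r normrN ler_norm.
Qed.

(* Between bounded heights only finitely many powers of [tau] matter. *)
Lemma hull_hausdorff : hausdorff_space (hull rho l).
Proof.
have hY : hausdorff_space Y.
  apply: hausdorff_pair; last exact: norm_hausdorff.
  exact/set_type_hausdorff/full_shift_hausdorff.
move=> w1 w2 cl; apply: contrapT => w12.
pose p := repr w1; pose q := repr w2.
have pq n : q <> iter n tau p /\ p <> iter n tau q.
  split=> E; apply: w12; rewrite -(reprK w1) -(reprK w2); apply/hull_eqP; exists n.
    by left.
  by right.
(* Points within height 1 of p and q that are n steps apart differ in height by at least n lm, yet
   by less than |p.2 - q.2| + 2; hence n < N. *)
have [N HN] := nat_above ((`|p.2 - q.2| + 2) / lm).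
have taun n := @iter_continuous tau n suspension_map_continuous.
have sep n : \forall z \near (p, q),
    z.2 <> iter n tau z.1 /\ z.1 <> iter n tau z.2.
  have c1 : {for (p, q), continuous (fun z : Y * Y => iter n tau z.1)}.
    by apply: (@continuous_comp _ _ _ fst (iter n tau)); [exact: cvg_fst|exact: taun].
  have c2 : {for (p, q), continuous (fun z : Y * Y => iter n tau z.2)}.
    by apply: (@continuous_comp _ _ _ snd (iter n tau)); [exact: cvg_snd|exact: taun].
  have cs : {for (p, q), continuous (snd : Y * Y -> Y)} by exact: cvg_snd.
  have cf : {for (p, q), continuous (fst : Y * Y -> Y)} by exact: cvg_fst.
  have h1 := near_neq hY cs c1 (pq n).1; have h2 := near_neq hY cf c2 (pq n).2.
  by apply: filterS2 h1 h2 => z.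
have near_height (u : Y) : \forall v \near u, `|u.2 - v.2| < 1.
  have : {for u, continuous (snd : Y -> R)} by exact: cvg_snd.
  by move=> /cvgrPdist_lt/(_ 1 ltr01).
have : \forall z \near (p, q), pr z.1 <> pr z.2.
  have H1 : \forall z \near (p, q), forall n, (n < N)%N ->
      z.2 <> iter n tau z.1 /\ z.1 <> iter n tau z.2.
    by apply: (@near_all_nat _ (nbhs (p, q)) (nbhs_filter (p, q)) (fun n z =>
      z.2 <> iter n tau z.1 /\ z.1 <> iter n tau z.2)) => n _; exact: sep.
  have H2 : \forall z \near (p, q), `|p.2 - z.1.2| < 1 /\ `|q.2 - z.2.2| < 1.
    exists ([set v | `|p.2 - v.2| < 1], [set v | `|q.2 - v.2| < 1]).
      by split; exact: near_height.
    by move=> z [].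
  apply: (@filterS2 _ _ (nbhs_filter (p, q)) _ _ _ _ H1 H2).
  move=> -[u v] /= {}H1 [pu qv] /hull_eqP[n vu].
  have nN : (n < N)%N.
    rewrite ltnNge; apply/negP => Nn; have := HN n Nn.
    rewrite ler_pdivrMr//; apply/negP; rewrite -ltNge.
    have uv : `|u.2 - v.2| < `|p.2 - q.2| + 2.
      rewrite (_ : u.2 - v.2 = (p.2 - q.2) - (p.2 - u.2) + (q.2 - v.2)); last by lra.
      have := ler_normD (p.2 - q.2 - (p.2 - u.2)) (q.2 - v.2).
      by have := ler_normB (p.2 - q.2) (p.2 - u.2); lra.
    apply: le_lt_trans uv; case: vu => /bounded_index; apply => //.
    by rewrite distrC.
  by have [h1 h2] := H1 n nN; case: vu.
move=> [[U V] /= [Up Vq] UV].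
have prnbhs u (W : set Y) : nbhs u W -> nbhs (pr u) (pr @` W).
  rewrite nbhsE => -[W' [oW' W'u] W'W].
  apply: (@filterS _ _ _ (pr @` W')); first exact: image_subset.
  by apply: open_nbhs_nbhs; split; [exact: hull_pi_open|exists u].
have := cl (pr @` U) (pr @` V).
rewrite -{1}(reprK w1) -{1}(reprK w2) => /(_ (prnbhs _ _ Up) (prnbhs _ _ Vq)).
by move=> [_ [[u Uu <-] [v Vv vu]]]; apply: (UV (u, v)).
Qed.

End HullTopology.

(** * Time averages of the tiling flow *)

Section RiemannSums.
Variable R : realType.
Implicit Types (u U : R -> R).

Lemma primitive_exists u (a b : R) : continuous u -> a < b ->
  exists U, forall x : R, x \in `]a, b[ -> is_derive x 1 U (u x).
Proof.
move=> cu ab.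
have iu : lebesgue_measure.-integrable `[a, b] (EFin \o u).
  apply: continuous_compact_integrable; first exact: segment_compact.
  exact: continuous_subspaceT.
exists (fun x => \int[lebesgue_measure]_(t in [set` `[a, x]]) u t)%R => x.
rewrite in_itv/= => /andP[ax xb].
have [dU UE] := continuous_FTC1_closed xb iu ax (cu x).
by rewrite -UE derive1E; exact: derivableP.
Qed.

(** Mean value theorem for a primitive. One [U] serves all subintervals, so different Riemann sums
    are compared with increments of the same function. *)
Lemma riemann_primitive u (a b : R) : continuous u -> a < b -> exists U,
  forall x y v w : R, a < x -> x <= y -> y < b ->
    (forall t, x <= t <= y -> `|u t - v| <= w) ->
    `|U y - U x - v * (y - x)| <= w * (y - x).
Proof.
move=> cu ab; have [U HU] := primitive_exists cu ab; exists U => x y v w ax xy yb H.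
have sub t : x <= t <= y -> t \in `]a, b[.
  move=> /andP[xt ty]; rewrite in_itv/=.
  by rewrite (lt_le_trans ax xt) (le_lt_trans ty yb).
have dU t : t \in `]x, y[ -> is_derive t 1 U (u t).
  rewrite in_itv/= => /andP[/ltW xt /ltW ty]; apply: HU; apply: sub.
  by rewrite xt ty.
have cU : {within `[x, y], continuous U}.
  apply: derivable_within_continuous => t; rewrite in_itv/= => /sub /HU dUt.
  exact: (@ex_derive _ _ _ _ _ _ _ dUt).
have [c cxy E] := MVT_segment xy dU cU.
rewrite in_itv/= in cxy; rewrite E -mulrBl normrM.
rewrite (ger0_norm (x := y - x)); last by rewrite subr_ge0.
by apply: ler_wpM2r; [rewrite subr_ge0|exact: H].
Qed.

Lemma telescope_bound U (p g : nat -> R) w n :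
  (forall i, (i < n)%N ->
    `|U (p i.+1) - U (p i) - g i| <= w * (p i.+1 - p i)) ->
  `|U (p n) - U (p 0%N) - \sum_(i < n) g i| <= w * (p n - p 0%N).
Proof.
elim: n => [|n IH] H; first by rewrite big_ord0 !subrr normr0 mulr0.
have h1 := IH (fun i ltin => H i (ltnW ltin)); have h2 := H n (ltnSn n).
rewrite big_ord_recr /=; set S := \sum_(i < n) _ in h1 *.
rewrite (_ : U (p n.+1) - U (p 0%N) - (S + g n) =
  (U (p n) - U (p 0%N) - S) + (U (p n.+1) - U (p n) - g n)); last by ring.
by apply: le_trans (ler_normD _ _) _; lra.
Qed.

End RiemannSums.

Section TilingFlow.
Variables (R : realType) (A : topologicalType) (rho : substitution A).
Hypotheses (cA : compact [set: A]) (hA : hausdorff_space A).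
Variable l : A -> R.
Hypothesis l_cont : continuous l.
Variables lm lM : R.
Hypotheses (lm_gt0 : 0 < lm) (l_bounds : forall a, lm <= l a <= lM).
Local Open Scope quotient_scope.
Local Notation X := (subshift rho).
Local Notation Y := (hull_cover R rho).
Local Notation Omega := (hull rho l).
Local Notation pr := (\pi_(hull rho l) : Y -> hull rho l).

Lemma translate_continuous t : continuous (@translate R A rho l t).
Proof.
apply/quotient_continuous.
rewrite (_ : translate t \o _ = pr \o (fun p : Y => (p.1, p.2 - t) : Y)); last first.
  by apply/funext => -[x s]; rewrite /= translateE.
move=> p; apply: (@continuous_comp Y Y Omega (fun p => (p.1, p.2 - t)) pr);
  last exact: pi_continuous.
exact: (cvg_pair cvg_fst (cvgB cvg_snd (cvg_cst t))).
Qed.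

Lemma translate_pi t p : translate t (pr p) = pr (p.1, p.2 - t).
Proof. by case: p => x s; exact: translateE. Qed.

Lemma hull_pi_surj (w : Omega) : exists p, w = pr p.
Proof. by exists (repr w); rewrite reprK. Qed.

Lemma translate0 (w : Omega) : translate 0 w = w.
Proof. by have [[x s] ->] := hull_pi_surj w; rewrite translate_pi subr0. Qed.

Lemma translateD s t (w : Omega) : translate (s + t) w = translate s (translate t w).
Proof.
have [[x u] ->] := hull_pi_surj w; rewrite !translate_pi /=.
by rewrite opprD addrA addrAC.
Qed.

Variable F : Omega -> R.
Hypothesis F_cont : continuous F.

Let Ft (x : X) (s : R) : R := F (pr (x, s)).

Let Ft_cont : continuous (fun p : Y => Ft p.1 p.2).
Proof.
rewrite (_ : (fun p => _) = F \o pr); last by apply/funext => -[].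
by apply/quotient_continuous.
Qed.

Let Ft_orbit_cont (x : X) : continuous (Ft x).
Proof.
move=> s; apply: (@continuous_comp R Y R (fun s => (x, s) : Y)
  (fun p => Ft p.1 p.2)); last exact: Ft_cont.
exact: (cvg_pair (cvg_cst x) cvg_id).
Qed.

(** The cover is not compact, but X times [0, lM] is. Equivalent points stay equivalent under the
    same vertical shift, so the modulus found there holds at all heights. *)
Lemma flow_modulus w : 0 < w -> exists2 d, 0 < d & forall x s t,
  `|s - t| <= d -> `|Ft x s - Ft x t| <= w.
Proof.
move=> w0; pose P (n : nat) (p : Y) := forall t, `|t| <= n.+1%:R^-1 ->
  `|Ft p.1 (p.2 + t) - Ft p.1 p.2| <= w.
have cK : compact ([set: X] `*` `[0, lM]%classic : set Y).
  by apply: compact_setX; [exact: subshift_compact|exact: segment_compact].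
have [|N _ HN] := (compact_near_coveringP _).1 cK nat \oo P _.
  move=> [x s] _; have w2 : 0 < w / 2 by rewrite divr_gt0.
  have /cvgrPdist_le/(_ _ w2) := @Ft_cont (x, s).
  move=> [[U V] /= [Ux Vs] UV].
  have [e e0 He] : exists2 e : R, 0 < e & forall t, `|s - t| < e -> V t.
    by have /nbhs_ballP[e /= e0 He] := Vs; exists e.
  have e2 : 0 < e / 2 by rewrite divr_gt0.
  have [N HN] := nat_above (e / 2)^-1.
  exists ((U `*` [set t | `|s - t| < e / 2]), [set n | (N <= n)%N]) => /=.
    split; last by exists N.
    exists (U, [set t | `|s - t| < e / 2]) => //=; split=> //.
    by apply/nbhs_ballP; exists (e / 2).
  move=> [[x' s'] n] /= [[Ux' ss'] Nn] t tn.
  have te : `|t| <= e / 2.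
    apply: le_trans tn _; rewrite invf_ple ?posrE//.
    by apply: HN; exact: leqW.
  have V1 : V s' by apply: He; lra.
  have V2 : V (s' + t).
    apply: He; rewrite opprD addrA; apply: le_lt_trans (ler_normB _ _) _; lra.
  have := UV (x', s') (conj Ux' V1); have := UV (x', s' + t) (conj Ux' V2).
  rewrite /= => h1 h2.
  rewrite (_ : _ - _ = (Ft x s - Ft x' s') - (Ft x s - Ft x' (s' + t))); last by ring.
  by apply: le_trans (ler_normB _ _) _; lra.
exists N.+1%:R^-1; first by rewrite invr_gt0.
move=> x s t st; have [x' [s' [E s'M]]] := hull_representative lm_gt0 l_bounds (pr (x, t)).
have FtE u : Ft x (t + u) = Ft x' (s' + u).
  rewrite /Ft -[u]opprK -!translateE; congr (F (translate _ _)); exact: E.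
rewrite (_ : Ft x s = Ft x' (s' + (s - t))); last by rewrite -FtE addrC subrK.
rewrite (_ : Ft x t = Ft x' s'); last by rewrite -[s']addr0 -FtE addr0.
by apply: (HN N (leqnn N) (x', s')) => //; split=> //=; rewrite in_itv.
Qed.

Let Ft_shift (x : X) j s :
  Ft x (\sum_(i < j) l (set_val x i%:Z) + s) = Ft (shift_byX j%:Z x) s.
Proof.
rewrite /Ft; congr F; apply/hull_eqP; exists j; left.
set p : Y := (x, _); have [h1 h2] := iter_suspension l j p.
rewrite [RHS]surjective_pairing h1 /= addrC addKr; congr pair.
exact/val_inj/esym.
Qed.

Let l_ge0 a : 0 <= l a.
Proof. by have /andP[h _] := l_bounds a; apply: le_trans h; exact: ltW. Qed.

Let height (x : X) (j : nat) : R := \sum_(i < j) l (set_val x i%:Z).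

Let heightS x j : height x j.+1 = height x j + l (set_val x j%:Z).
Proof. by rewrite /height big_ord_recr. Qed.

Let height_ge x j : j%:R * lm <= height x j.
Proof.
rewrite mulr_natl -[j in leLHS]card_ord -sumr_const.
by apply: ler_sum => i _; case/andP: (l_bounds (set_val x i%:Z)).
Qed.

Let height_le x j : height x j <= j%:R * lM.
Proof.
rewrite mulr_natl -[j in leRHS]card_ord -sumr_const.
by apply: ler_sum => i _; case/andP: (l_bounds (set_val x i%:Z)).
Qed.

Let height_mono x i j : (i <= j)%N -> height x i <= height x j.
Proof.
move=> /subnKC <-; elim: (j - i)%N => [|k IH]; first by rewrite addn0.
by rewrite addnS heightS (le_trans IH)// lerDl.
Qed.

Let tile_sum (k0 : nat) (x : X) : R :=
  \sum_(k < k0) Ft x (k%:R * (l (set_val x 0) / k0%:R)) * (l (set_val x 0) / k0%:R).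

Let tile_sum_continuous k0 : continuous (tile_sum k0).
Proof.
move=> x; have h_cont : {for x, continuous (fun x : X => l (set_val x 0) / k0%:R)}.
  have l0_cont : {for x, continuous (fun x : X => l (set_val x 0))}.
    apply: (@continuous_comp X A R (fun x => set_val x 0) l); last exact: l_cont.
    apply: (@continuous_comp X {ptws int -> A} A set_val (fun x => x 0)).
      exact: initial_continuous.
    exact: ptws_continuous.
  exact: (cvgM l0_cont (cvg_cst _)).
apply: (@cvg_bigsum R _ _ (nbhs x) (nbhs_filter x)) => k.
have Fk_cont : {for x, continuous
    (fun x : X => Ft x ((k : nat)%:R * (l (set_val x 0) / k0%:R)))}.
  apply: (@continuous_comp X Y R
    (fun x => (x, (k : nat)%:R * (l (set_val x 0) / k0%:R)) : Y) (fun p => Ft p.1 p.2)).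
    exact: (cvg_pair cvg_id (cvgM (cvg_cst _) h_cont)).
  exact: Ft_cont.
exact: (cvgM Fk_cont h_cont).
Qed.

Let tile_sum_extension k0 : exists2 G : {ptws int -> A} -> R, continuous G &
  forall x : X, G (set_val x) = tile_sum k0 x.
Proof.
have [[x0 _]|noX] := pselect (exists x : X, True); last first.
  exists (fun=> 0); first exact: cst_continuous.
  by move=> x; case: noX; exists x.
have [B B0 HB] : exists2 B : R, 0 <= B & forall x : X, `|tile_sum k0 x| <= B.
  exact: (compact_norm_bound (@subshift_compact A rho cA) x0 (@tile_sum_continuous k0)).
pose f (x : {ptws int -> A}) : R :=
  if pselect (subshift rho x) is left Xx then tile_sum k0 (SigSub (mem_set Xx)) else 0.
have fE (x : X) : f (set_val x) = tile_sum k0 x.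
  rewrite /f; case: pselect => [Xx|]; last by move=> /(_ (set_valP x)).
  by congr (tile_sum k0); exact: val_inj.
have nX : normal_space {ptws int -> A}.
  by apply: compact_normal; [exact: full_shift_hausdorff|exact: full_shift_compact].
have cf : {within subshift rho, continuous f}.
  apply/subspace_sigL_continuousP.
  rewrite (_ : sigL _ f = tile_sum k0); first exact: tile_sum_continuous.
  by apply/funext => x; rewrite /sigL /=; exact: fE.
(* Tietze's theorem asks for a positive bound, while [B] may be 0. *)
have B1 : 0 < B + 1 by rewrite ltr_wpDl.
have fB x : subshift rho x -> `|f x| <= B + 1.
  move=> Xx; have := fE (SigSub (mem_set Xx)); rewrite /= => ->.
  by rewrite (le_trans (HB _))// lerDl.
have [g [fg cg _]] := continuous_bounded_extension nX (@subshift_closed A rho) B1 cf fB.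
exists g => // x; rewrite -fE; apply/esym/fg.
by apply: mem_set; exact: set_valP.
Qed.

(** Both sums approximate increments of one primitive along the orbit, the time sum over [s, t] and
    the tile sums over [0, height x j]. The end points differ by at most [lM] on each side, which
    costs 2 B lM. *)
Let time_sum_tile_sum (k0 : nat) (w d B : R) x n s j : (0 < k0)%N -> 0 < d ->
  (forall x s, `|Ft x s| <= B) ->
  (forall x s t, `|s - t| <= d -> `|Ft x s - Ft x t| <= w) -> lM / k0%:R <= d ->
  0 <= s <= lM -> height x j <= s + n%:R * d <= height x j + lM ->
  `|d * \sum_(i < n) Ft x (s + i%:R * d) -
    \sum_(i < j) tile_sum k0 (shift_byX i%:Z x)| <=
  w * (n%:R * d) + w * height x j + 2 * B * lM.
Proof.
move=> k0_gt0 d_gt0 FB modulus k0_large /andP[s0 sM]; set t := s + n%:R * d => /andP[jt tj].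
have nd0 : 0 <= n%:R * d by rewrite mulr_ge0// ltW.
have k0R : 0 < k0%:R :> R by rewrite ltr0n.
have height0 : height x 0 = 0 by rewrite /height big_ord0.
have height_ge0 i : 0 <= height x i by rewrite -height0; exact: height_mono.
(* A margin of 1 on both sides puts [0, t] inside the open interval where [U] is controlled. *)
have ab : -1 < t + 1 by rewrite /t; lra.
have [U HU] := riemann_primitive (@Ft_orbit_cont x) ab.
have B0 : 0 <= B by exact: le_trans (FB x 0).
have crude y z : 0 <= y -> y <= z -> z <= t -> z - y <= lM -> `|U z - U y| <= B * lM.
  move=> y0 yz zt zy.
  have := HU y z 0 B; rewrite mul0r subr0 => H.
  apply: le_trans (H _ yz _ _) (ler_wpM2l B0 zy); [lra|lra|].
  by move=> v _; rewrite subr0.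
have fine y z v : 0 <= y -> y <= z -> z <= t -> z - y <= d -> v = y ->
    `|U z - U y - Ft x v * (z - y)| <= w * (z - y).
  move=> y0 yz zt zy ->; apply: HU => //; [lra|lra|].
  move=> v' /andP[yv vz]; apply: modulus.
  by rewrite ger0_norm ?subr_ge0//; lra.
have h1 : `|U t - U s - d * \sum_(i < n) Ft x (s + i%:R * d)| <= w * (n%:R * d).
  have H i : (i < n)%N -> `|U (s + i.+1%:R * d) - U (s + i%:R * d) -
      d * Ft x (s + i%:R * d)| <= w * (s + i.+1%:R * d - (s + i%:R * d)).
    move=> ltin; have E : s + i.+1%:R * d - (s + i%:R * d) = d by rewrite -natr1; ring.
    have i0 : 0 <= i%:R * d by rewrite mulr_ge0// ltW.
    have iSn : i.+1%:R * d <= n%:R * d by rewrite ler_wpM2r ?ler_nat// ltW.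
    rewrite E [d * Ft _ _]mulrC.
    have := fine (s + i%:R * d) (s + i.+1%:R * d) (s + i%:R * d).
    rewrite E; apply => //; first by rewrite addr_ge0.
    - by rewrite -subr_ge0 E ltW.
    - by rewrite /t lerD2l.
  have := telescope_bound H; rewrite mul0r addr0 -mulr_sumr.
  by rewrite -/t (_ : t - s = n%:R * d)// /t addrC addKr.
have h2 : `|U (height x j) - U 0 - \sum_(i < j) tile_sum k0 (shift_byX i%:Z x)| <=
    w * height x j.
  suff H i : (i < j)%N -> `|U (height x i.+1) - U (height x i) -
      tile_sum k0 (shift_byX i%:Z x)| <= w * (height x i.+1 - height x i).
    have := @telescope_bound R U (height x) (fun i => tile_sum k0 (shift_byX i%:Z x)) w j H.
    by rewrite height0 subr0.
  move=> ij.
  set h := l (set_val x i%:Z) / k0%:R.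
  have hE : l (set_val x i%:Z) = k0%:R * h by rewrite mulrC divfK// gt_eqF.
  have h0 : 0 <= h.
    by rewrite divr_ge0 ?(ltW k0R).
  have hd : h <= d.
    apply: le_trans k0_large; rewrite ler_pM2r ?invr_gt0//.
    by case/andP: (l_bounds (set_val x i)).
  have -> : tile_sum k0 (shift_byX i%:Z x) =
      \sum_(k < k0) Ft x (height x i + k%:R * h) * h.
    rewrite /tile_sum shift_byXE add0r -/h; apply: eq_bigr => k _.
    by rewrite /height Ft_shift.
  have := @telescope_bound R U (fun k => height x i + k%:R * h)
    (fun k => Ft x (height x i + k%:R * h) * h) w k0.
  rewrite mul0r addr0 -hE -heightS; apply => k kk0.
  have E : height x i + k.+1%:R * h - (height x i + k%:R * h) = h.
    by rewrite -natr1; ring.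
  have kh : 0 <= k%:R * h by rewrite mulr_ge0.
  have kS : k.+1%:R * h <= k0%:R * h by rewrite ler_wpM2r ?ler_nat.
  have iS : height x i.+1 <= t by apply: le_trans jt; exact: height_mono.
  rewrite heightS hE in iS.
  rewrite E; have := fine (height x i + k%:R * h) (height x i + k.+1%:R * h)
    (height x i + k%:R * h).
  rewrite E; apply => //; first by rewrite addr_ge0.
  - by rewrite -subr_ge0 E.
  - by apply: le_trans iS; rewrite lerD2l.
have h3 : `|U t - U (height x j)| <= B * lM by apply: crude => //; lra.
have h4 : `|U s - U 0| <= B * lM by apply: crude => //; rewrite /t; lra.
move: h1 h2 h3 h4; set P := d * _; set Q := \sum_(i < j) _.
move=> h1 h2 h3 h4; rewrite (_ : P - Q = - (U t - U s - P) + (U t - U (height x j))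
  - (U s - U 0) + (U (height x j) - U 0 - Q)); last by ring.
apply: le_trans (ler_normD _ _) _; apply: (@le_trans _ _
  (w * (n%:R * d) + B * lM + B * lM + w * height x j)); last by lra.
apply: lerD => //; apply: le_trans (ler_normB _ _) _; apply: lerD => //.
by apply: le_trans (ler_normD _ _) _; rewrite normrN; exact: lerD.
Qed.

Hypothesis frequencies : forall G : {ptws int -> A} -> R, continuous G ->
  forall e, 0 < e -> exists c N, forall n, (N <= n)%N -> forall x, X x ->
    `|orbit_sum G x 0 n - c * \sum_(i < n) l (x i%:Z)| <= e * n%:R.

(* A long time average of [F] is close to the integral of [F] along the orbit,
   hence to the sum over the tiles met of Riemann sums with [k0] points per
   tile. These are values of a continuous function on the subshift, which
   extends to the full shift by Tietze's theorem. *)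
Lemma hull_time_averages (w0 : Omega) e : 0 < e -> exists s c,
  (0 < size s)%N /\
  forall w : Omega, `|time_average (@translate R A rho l) s F w - c| <= e.
Proof.
move=> e0; have e6 : 0 < e / 6 by rewrite divr_gt0.
have [B B0 FB] := compact_norm_bound (hull_compact cA lm_gt0 l_bounds) w0 F_cont.
have [d d0 modulus] := flow_modulus e6.
have [k1 Hk1] := nat_above (lM / d); pose k0 := k1.+1.
have k0_large : lM / k0%:R <= d.
  rewrite ler_pdivrMr ?ltr0n// mulrC -ler_pdivrMr//; exact: Hk1.
have [G cG GE] := tile_sum_extension k0.
have [c [n0 Hfreq]] := frequencies cG (mulr_gt0 e6 lm_gt0).
(* [K] gathers the errors that do not grow with [N]; [N1] makes it at most half of the allowed e N
   d. The other half is three times e / 6: time sum, tile sums, frequency. [N2] ensures that at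
   least [n0] tiles are covered. *)
pose K := 2 * B * lM + `|c| * lM + e / 3 * lM.
have [N1 HN1] := nat_above (K / (e / 2) / d).
have [N2 HN2] := nat_above (n0%:R * lM / d).
pose N := (maxn N1 N2).+1.
have N1N : (N1 <= N)%N by rewrite /N leqW// leq_maxl.
have N2N : (N2 <= N)%N by rewrite /N leqW// leq_maxr.
have N0 : 0 < N%:R :> R by rewrite ltr0n.
have KN : K <= N%:R * d * (e / 2).
  have := HN1 _ N1N; rewrite ler_pdivrMr// ler_pdivrMr ?divr_gt0//.
have n0N : n0%:R * lM <= N%:R * d by have := HN2 _ N2N; rewrite ler_pdivrMr.
(* [translate] subtracts the time from the height, so negative times move forward along the
   orbit. *)
exists [seq - (i%:R * d) | i <- iota 0 N], c; split; first by rewrite size_map size_iota.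
move=> w; have [x [s [-> sM]]] := hull_representative lm_gt0 l_bounds w.
have -> : time_average (@translate R A rho l) [seq - (i%:R * d) | i <- iota 0 N] F
    (pr (x, s)) = (\sum_(i < N) Ft x (s + i%:R * d)) / N%:R.
  rewrite /time_average size_map size_iota big_map; congr (_ / _).
  rewrite -(big_mkord xpredT (fun i => Ft x (s + i%:R * d))) /index_iota subn0.
  by apply: eq_bigr => i _; rewrite translate_pi /= opprK.
pose T := s + N%:R * d; have [s0 slM] := andP sM.
have exJ : exists j, T < height x j.+1.
  have [j Hj] := nat_above (T / lm); exists j.
  have := Hj j (leqnn j); rewrite ler_pdivrMr// => /le_lt_trans; apply.
  by apply: lt_le_trans (height_ge x j.+1); rewrite ltr_pM2r// ltr_nat.
(* [J] is the index of the tile containing the end point [T]. *)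
case: (ex_minnP exJ) => J TJ Jmin.
have JT : height x J <= T.
  case: J TJ Jmin => [|J] _ Jmin.
    by rewrite /height big_ord0 addr_ge0// mulr_ge0 ?ltW.
  by rewrite leNgt; apply/negP => /Jmin; rewrite ltnn.
have lJ : l (set_val x J%:Z) <= lM by case/andP: (l_bounds (set_val x J%:Z)).
have TJ' : T <= height x J + lM by move: TJ; rewrite heightS; lra.
have n0J : (n0 <= J)%N.
  have lM0 : 0 < lM.
    have /andP[h1 h2] := l_bounds (set_val x 0).
    exact: lt_le_trans (le_trans h1 h2).
  rewrite -ltnS -(ltr_nat R) -(ltr_pM2r lM0).
  apply: le_lt_trans n0N _; apply: le_lt_trans (lt_le_trans TJ (height_le x J.+1)).
  by rewrite /T lerDr.
have JTT : height x J <= s + N%:R * d <= height x J + lM by rewrite JT TJ'.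
have est := time_sum_tile_sum (isT : (0 < k0)%N) d0 (fun x s => FB (pr (x, s)))
  modulus k0_large sM JTT.
have := Hfreq J n0J (set_val x) (set_valP x).
have -> : orbit_sum G (set_val x) 0 J = \sum_(i < J) tile_sum k0 (shift_byX i%:Z x).
  by apply: eq_bigr => i _; rewrite add0r -GE.
rewrite -/(height x J); move: est; set P := d * _; set Q := \sum_(i < J) _.
set S := height x J in JT TJ' JTT * => est freq.
have h1 : e / 6 * lm * J%:R <= e / 6 * S.
  by rewrite -mulrA; apply: ler_wpM2l; [exact: ltW|rewrite mulrC; exact: height_ge].
have h2 : `|c * S - c * (N%:R * d)| <= `|c| * lM.
  rewrite -mulrBr normrM; apply: ler_wpM2l => //.
  by rewrite ler_distl; apply/andP; split; move: JT TJ' s0 slM; rewrite /T; lra.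
have h3 : `|P - c * (N%:R * d)| <= e * (N%:R * d).
  rewrite (_ : _ - _ = (P - Q) + (Q - c * S) + (c * S - c * (N%:R * d))); last by ring.
  apply: le_trans (ler_normD _ _) _.
  apply: le_trans (lerD (ler_normD _ _) (lexx _)) _.
  have h4 : e / 6 * S <= e / 6 * (N%:R * d + lM).
    by apply: ler_wpM2l; [exact: ltW|move: JT; rewrite /T; lra].
  by move: KN; rewrite /K; lra.
have Nd0 : 0 < N%:R * d by exact: mulr_gt0.
rewrite -(ler_pM2r Nd0) -{1}(gtr0_norm Nd0) -normrM.
rewrite (_ : _ * (N%:R * d) = P - c * (N%:R * d))// /P.
by field; rewrite gt_eqF.
Qed.

End TilingFlow.

Theorem theorem5p22 (R : realType) (A : topologicalType)
    (rho : substitution A) :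
  compact [set: A] -> hausdorff_space A ->
  (exists a, (1 < size (rho a))%N) ->
  irreducible rho ->
  strongly_power_convergent
    (fun (f : A -> R) a => subst_op rho f a / spectral_radius R rho) ->
  exists l : A -> R,
    [/\ natural_length rho l (spectral_radius R rho),
        1 < spectral_radius R rho,
        forall (l' : A -> R) (lambda' : R), natural_length rho l' lambda' ->
          exists c : R, forall a, l' a = c * l a,
        forall a, 0 < l a &
        uniquely_ergodic (@translate R A rho l)].
Proof.
move=> cA hA expanding irr conv.
have [l nl] := natural_length_exists cA expanding conv.
have l_gt0 := natural_length_gt0 irr nl.
have r_gt1 := spectral_radius_gt1 cA irr expanding nl.
exists l; split=> //.
  by move=> l' lambda' nl'; exact: (natural_length_unique cA irr expanding nl nl').
have l_cont : continuous l by case: nl.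
have [lm [lM [lm_gt0 _ l_bounds]]] := length_bounds cA irr expanding nl.
have [C C_gt0 HC] := size_subst_iter_bounds cA irr expanding nl.
(* Unique ergodicity includes existence of a measure, so the hull needs a point; r > 1 provides
   arbitrarily long iterates, hence a point of the subshift. *)
have [x Xx] : subshift rho !=set0.
  apply: (subshift_nonempty cA) => n; have [a _] := expanding.
  have [k Hk] := exp_above (C * n%:R) r_gt1; exists k, a.
  rewrite -(ler_nat R) -(ler_pM2l C_gt0).
  exact: le_trans Hk (HC k a).2.
pose w0 : hull rho l := \pi_(hull rho l)%qT (SigSub (mem_set Xx), 0).
apply: (uniquely_ergodic_of_averages (hull_compact cA lm_gt0 l_bounds)
  (hull_hausdorff hA l_cont lm_gt0 l_bounds) (@translate_continuous R A rho l)
  (@translate0 R A rho l) (@translateD R A rho l) _ w0) => F cF e e_gt0.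
apply: (hull_time_averages cA hA l_cont lm_gt0 l_bounds cF _ w0 e_gt0) => G cG.
exact: (uniform_frequencies cA hA irr expanding conv nl cG).
Qed.
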